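(* Assume $B\in L^{\hat U}$, $(B+\mathcal C)\cap\mathcal D\neq\emptyset$, and $$u(B)=\sup_{X\in\mathcal C}I_U(B+X)=\sup_{X\in\mathcal C^{\ast\ast}}I_U(B+X).$$ Suppose $U$ is superlinear at $-\infty$, i.e. $\lim_{x\to-\infty}U(x)/x=\infty$ (this includes the case where $U=-\infty$ on some half-line $(-\infty,\underline x)$). Then there are a sequence $\{Z_n\}\subseteq M^{\hat V}$ with $\|Z_n\|_{\hat V}\to0$ and a sequence $\{Y_n\}\subseteq\mathcal C^{\ast}$ such that $$\lim_{n\to\infty}\big(I_V(Y_n+Z_n)+E[(Y_n+Z_n)B]\big)=u(B).$$
   Context: Utility. $U:\mathbb R\to[-\infty,\infty)$ is proper, concave, non-decreasing and upper semicontinuous; $\mathrm{dom}\,U=\{x: U(x)>-\infty\}$, $\underline x=\inf \mathrm{dom}\,U$, $U(\infty)=\lim_{x\to\infty}U(x)$, $\overline x=\inf\{x: U(x)=U(\infty)\}$. Standing convention: $\underline x<0<\overline x$ and $U(0)=0$. Let $V(y)=\sup_{x\in\mathbb R}\{U(x)-xy\}\in[0,\infty]$, $\hat U(x)=-U(-|x|)$ and $\hat V(y)=\sup_{x\in\mathbb R}\{xy-\hat U(x)\}$ (a conjugate pair of Young functions, possibly taking the value $+\infty$). Orlicz spaces. On $(\Omega,\mathcal F_T,P)$, for $\Phi\in\{\hat U,\hat V\}$: $L^{\Phi}=\{X\in L^0: E[\Phi(\lambda X)]<\infty\text{ for some }\lambda>0\}$, $M^{\Phi}=\{X\in L^0: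 E[\Phi(\lambda X)]<\infty\text{ for all }\lambda>0\}$, norm $\|X\|_\Phi=\inf\{\lambda>0: E[\Phi(X/\lambda)]\le1\}$. $I_f(X)=E[f(X)]$; $\mathcal D=\{X\in L^{\hat U}: I_U(X)>-\infty\}$. Market. $(\Omega,(\mathcal F_t)_{t\in[0,T]},P)$ is a filtered probability space, $S$ a (finite-dimensional) semimartingale, $L(S)$ the set of predictable $S$-integrable processes, $H\cdot S_t=\int_{(0,t]}H\,dS$. Tame strategies: $\mathscr T=\{H\in L(S):\inf_{t\in[0,T]}H\cdot S_t\in L^{\hat U}\}$. $\mathcal K=\{H\cdot S_T: H\in\mathscr T\}$, $\mathcal C=(\mathcal K-L^0_+)\cap L^{\hat U}$ (a convex cone). Polars in the duality $(L^{\hat U},M^{\hat V})$. $\mathcal C^{\ast}=\{Y\in M^{\hat V}: E[XY]\le0\ \forall X\in\mathcal C\}$, $\mathcal C^{\ast\ast}=\{X\in L^{\hat U}: E[XY]\le0\ \forall Y\in\mathcal C^{\ast}\}$. *)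

(* Defs.v *)
From HB Require Import structures.
From mathcomp Require Import all_boot all_order all_algebra.
From mathcomp Require Import all_classical all_reals all_analysis.

Set Implicit Arguments.
Unset Strict Implicit.
Unset Printing Implicit Defensive.

Import Order.TTheory GRing.Theory Num.Theory.
Import numFieldNormedType.Exports.

Local Open Scope classical_set_scope.
Local Open Scope ring_scope.

(** * Utility functions and their conjugates *)

Section Utility.
Context {R : realType}.
Implicit Types U f : R -> \bar R.

Definition effective_domain U : set R := [set x | (-oo < U x)%E].

Definition lower_endpoint U : \bar R :=
  ereal_inf [set x%:E | x in effective_domain U].

Definition value_at_infinity U : \bar R := lim (U x @[x --> +oo]).

Definition upper_endpoint U : \bar R :=
  ereal_inf [set x%:E | x in [set x | U x = value_at_infinity U]].

Definition concave U : Prop := forall t x y : R, 0 < t -> t < 1 ->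
  (t%:E * U x + (1 - t)%:E * U y <= U (t * x + (1 - t) * y)%R)%E.

Record utility U : Prop := {
  utility_lty : forall x, (U x < +oo)%E ;
  utility_proper : effective_domain U !=set0 ;
  utility_concave : concave U ;
  utility_nondecreasing : {homo U : x y / x <= y >-> (x <= y)%E} ;
  utility_usc : lower_semicontinuous (fun x => - U x)%E ;
  utility_lower_endpoint : (lower_endpoint U < 0)%E ;
  utility_upper_endpoint : (0 < upper_endpoint U)%E ;
  utility0 : U 0 = 0%E
}.

Definition conjugate_utility U (y : R) : \bar R :=
  ereal_sup [set (U x - (x * y)%:E)%E | x in [set: R]].

Definition young_utility U (x : R) : \bar R := (- U (- `|x|)%R)%E.

Definition conjugate_young_utility U (y : R) : \bar R :=
  ereal_sup [set ((x * y)%:E - young_utility U x)%E | x in [set: R]].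

Definition superlinear_at_ninfty U : Prop :=
  (U x * (x^-1)%:E)%E @[x --> -oo] --> +oo%E.

End Utility.

(** * Orlicz spaces.  Elements of L^0 are represented by real-valued measurable
    functions; every set of random variables below is stable under almost sure
    equality. *)

Section Orlicz.
Context {d : measure_display} {Omega : measurableType d} {R : realType}.
Variable P : probability Omega R.
Implicit Types (f Phi : R -> \bar R) (X : Omega -> R).

Definition integral_functional f X : \bar R := (\int[P]_w f (X w))%E.

Definition orlicz_space Phi : set (Omega -> R) :=
  [set X | measurable_fun [set: Omega] X /\
    exists2 l : R, 0 < l & (\int[P]_w Phi (l * X w)%R < +oo)%E].

Definition orlicz_heart Phi : set (Omega -> R) :=
  [set X | measurable_fun [set: Omega] X /\
    forall l : R, 0 < l -> (\int[P]_w Phi (l * X w)%R < +oo)%E].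

Definition luxemburg_norm Phi X : \bar R :=
  ereal_inf [set l%:E | l in
    [set l : R | 0 < l /\ (\int[P]_w Phi (X w / l)%R <= 1)%E]].

Definition utility_domain (U : R -> \bar R) : set (Omega -> R) :=
  [set X | orlicz_space (young_utility U) X /\
    (-oo < integral_functional U X)%E].

Definition polar (U : R -> \bar R) (C : set (Omega -> R)) :
    set (Omega -> R) :=
  [set Y | orlicz_heart (conjugate_young_utility U) Y /\
    forall X, C X -> ('E_P[X \* Y] <= 0)%E].

Definition bipolar (U : R -> \bar R) (C : set (Omega -> R)) :
    set (Omega -> R) :=
  [set X | orlicz_space (young_utility U) X /\
    forall Y, polar U C Y -> ('E_P[X \* Y] <= 0)%E].

(* The supremum of I_U(B + X) over X in C. *)
Definition optimal_utility (U : R -> \bar R) (B : Omega -> R)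
    (C : set (Omega -> R)) : \bar R :=
  ereal_sup [set integral_functional U (B \+ X) | X in C].

End Orlicz.

(** * Stochastic integration over the time interval [0, T].  A process is a
    function on R * Omega of which only the times in [0, T] matter. *)

Section StochasticIntegration.
Context {d : measure_display} {Omega : measurableType d} {R : realType}.
Variables (P : probability Omega R) (T : R) (F : R -> set (set Omega)).

Local Notation process := (R -> Omega -> R).

(* The sigma-algebra of [Omega] itself is F_T. *)
Definition filtration : Prop :=
  [/\ forall t, 0 <= t <= T -> sigma_algebra [set: Omega] (F t),
      forall s t, 0 <= s -> s <= t -> t <= T -> F s `<=` F t &
      F T = @measurable d Omega].

Definition measurable_wrt (G : set (set Omega)) (X : Omega -> R) : Prop :=
  forall B : set R, measurable B -> G (X @^-1` B).

Definition adapted (X : process) : Prop :=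
  forall t, 0 <= t <= T -> measurable_wrt (F t) (X t).

Definition cadlag (X : process) : Prop := forall w : Omega,
  (forall t, 0 <= t < T -> X s w @[s --> t^'+] --> X t w) /\
  (forall t, 0 < t <= T -> cvg (X s w @[s --> t^'-])).

Definition martingale (M : process) : Prop :=
  [/\ adapted M,
      forall t, 0 <= t <= T -> P.-integrable [set: Omega] (EFin \o M t) &
      forall s t A, 0 <= s -> s <= t -> t <= T -> F s A ->
        (\int[P]_(w in A) (M t w)%:E = \int[P]_(w in A) (M s w)%:E)%E].

(* Any value exceeding T stands for infinity. *)
Definition stopping_time (tau : Omega -> R) : Prop :=
  (forall w, 0 <= tau w) /\
  (forall t, 0 <= t <= T -> F t [set w | tau w <= t]).

Definition stopped (tau : Omega -> R) (X : process) : process :=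
  fun t w => X (Num.min t (tau w)) w.

Definition local_martingale (M : process) : Prop :=
  [/\ adapted M, cadlag M &
      exists tau : nat -> Omega -> R,
        [/\ forall n, stopping_time (tau n),
            forall n w, tau n w <= tau n.+1 w,
            {ae P, forall w, exists n, T <= tau n w} &
            forall n, martingale (stopped (tau n) M)]].

Definition finite_variation (A : process) : Prop :=
  [/\ adapted A, cadlag A & forall w, bounded_variation 0 T (A ^~ w)].

Definition semimartingale (X : process) : Prop :=
  [/\ adapted X, cadlag X &
      exists M A : process,
        [/\ local_martingale M /\ (forall w, M 0 w = 0),
            finite_variation A /\ (forall w, A 0 w = 0) &
            {ae P, forall w, forall t, 0 <= t <= T ->
              X t w = X 0 w + M t w + A t w}]].

(* The predictable sigma-algebra on [0, T] * Omega. *)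
Definition predictable_sets : set (set (R * Omega)) :=
  <<s `[0, T] `*` [set: Omega],
      [set D | exists2 A, F 0 A & D = [set 0] `*` A] `|`
      [set D | exists s t A,
        [/\ 0 <= s, s <= t, t <= T, F s A & D = `]s, t] `*` A]] >>.

Definition predictable (H : process) : Prop :=
  forall B : set R, measurable B -> predictable_sets
    ((`[0, T] `*` [set: Omega]) `&` [set p | B (H p.1 p.2)]).

(* The integrand sum_(k < pieces) height_k * 1_(]left_k, right_k]). *)
Record simple_integrand := SimpleIntegrand {
  pieces : nat ;
  left_end : nat -> R ;
  right_end : nat -> R ;
  height : nat -> Omega -> R
}.

Definition simple_predictable (K : simple_integrand) : Prop :=
  forall k, (k < pieces K)%N ->
    [/\ 0 <= left_end K k, left_end K k <= right_end K k, right_end K k <= T,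
        measurable_wrt (F (left_end K k)) (height K k) &
        exists c : R, forall w, `|height K k w| <= c].

Definition simple_value (K : simple_integrand) : process := fun t w =>
  \sum_(k < pieces K) height K k w * \1_(`]left_end K k, right_end K k]) t.

Definition simple_integral (K : simple_integrand) (X : process) : process :=
  fun t w => \sum_(k < pieces K) height K k w *
    (X (Num.min (right_end K k) t) w - X (Num.min (left_end K k) t) w).

(* The event that sup_(t in [0, T]) |X_t| > e. *)
Definition sup_exceeds (X : process) (e : R) : set Omega :=
  [set w | exists2 t, 0 <= t <= T & e < `|X t w|].

Definition ucp_cvg (Xn : nat -> process) (X : process) : Prop :=
  forall e : R, 0 < e ->
    P (sup_exceeds (fun t w => Xn n t w - X t w) e) @[n --> \oo] --> 0%E.

(* [bounded_integral X H Y] : Y is a version of H . X, for H a bounded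
   predictable integrand and X a semimartingale.  This is the graph of the
   closure of the integral of simple integrands under bounded pointwise
   convergence of the integrands, the integrals converging uniformly in
   probability (dominated convergence theorem for stochastic integrals). *)
Inductive bounded_integral (X : process) : process -> process -> Prop :=
| bounded_integral_simple (K : simple_integrand) (H Y : process) :
    simple_predictable K ->
    (forall t w, 0 < t <= T -> H t w = simple_value K t w) ->
    (forall t w, 0 <= t <= T -> Y t w = simple_integral K X t w) ->
    bounded_integral X H Y
| bounded_integral_lim (Hn Yn : nat -> process) (H Y : process) (c : R) :
    (forall n, bounded_integral X (Hn n) (Yn n)) ->
    (forall n t w, 0 < t <= T -> `|Hn n t w| <= c) ->
    (forall t w, 0 < t <= T -> Hn n t w @[n --> \oo] --> H t w) ->
    (forall t, 0 <= t <= T -> measurable_fun [set: Omega] (Y t)) ->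
    cadlag Y ->
    ucp_cvg Yn Y ->
    bounded_integral X H Y.

(* Convergence in Emery's semimartingale topology, for null initial values.
   Testing against simple |K| <= 1 gives the same topology as testing against
   all predictable |K| <= 1. *)
Definition emery_cvg (Xn : nat -> process) (X : process) : Prop :=
  forall e : R, 0 < e ->
    ereal_sup [set P (sup_exceeds
                 (simple_integral K (fun t w => Xn n t w - X t w)) e) |
      K in [set K | simple_predictable K /\
                    forall t w, 0 < t <= T -> `|simple_value K t w| <= 1]]
    @[n --> \oo] --> 0%E.

Definition truncate m (n : nat) (H : 'I_m -> process) : 'I_m -> process :=
  fun i t w => if [forall j, `|H j t w| <= n%:R] then H i t w else 0.

(* [stochastic_integral S H Y] : the predictable process H is S-integrable and
   Y is a version of the vector stochastic integral H . S.  By definition this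
   means that the integrals of H 1_{|H| <= n}, which are sums of componentwise
   integrals, converge to Y in the semimartingale topology. *)
Definition stochastic_integral m (S H : 'I_m -> process) (Y : process) : Prop :=
  [/\ forall i, predictable (H i),
      (forall t, 0 <= t <= T -> measurable_fun [set: Omega] (Y t)) /\ cadlag Y,
      {ae P, forall w, Y 0 w = 0} &
      exists W : nat -> 'I_m -> process,
        (forall n i, bounded_integral (S i) (truncate n H i) (W n i)) /\
        emery_cvg (fun n t w => \sum_(i < m) W n i t w) Y].

(** * The market *)

Definition running_infimum (Y : process) (w : Omega) : R :=
  inf [set Y t w | t in `[0, T]].

(* S-integrability of H is contained in [stochastic_integral S H Y]. *)
Definition tame (U : R -> \bar R) m (S H : 'I_m -> process) : Prop :=
  exists2 Y, stochastic_integral S H Y &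
    orlicz_space P (young_utility U) (running_infimum Y).

Definition terminal_gains (U : R -> \bar R) m (S : 'I_m -> process) :
    set (Omega -> R) :=
  [set k | measurable_fun [set: Omega] k /\
    exists H Y, [/\ tame U S H, stochastic_integral S H Y &
                    {ae P, forall w, k w = Y T w}]].

Definition superreplicable (U : R -> \bar R) m (S : 'I_m -> process) :
    set (Omega -> R) :=
  [set X | orlicz_space P (young_utility U) X /\
    exists k f : Omega -> R, [/\ terminal_gains U S k,
      measurable_fun [set: Omega] f /\ {ae P, forall w, 0 <= f w} &
      {ae P, forall w, X w = k w - f w}]].

End StochasticIntegration.

(* Main.v *)
(* Let J(W) = I_V(W) + E[W B] on the heart M of Vhat.  Fenchel's inequality gives
   I_U(B + X) <= J(Y + Z) + E[|X Z|] for X in C, Y in C* and Z in M, so J(Y + Z)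
   cannot fall asymptotically below u(B) as the norm of Z tends to 0.

   Conversely, if J(Y + Z) > u(B) + e for all Y in C* and all Z of norm at most e,
   then the concave function u(B) + e - J(W) lies below K |W - Y| for a constant
   K, and Hahn-Banach in Mazur-Orlicz form produces a linear functional l <= K |.|
   on M that is nonpositive on C* and satisfies J + l >= u(B) + e.  Superlinearity
   of U makes Vhat finite, so M contains the bounded variables and l is order
   continuous; by Radon-Nikodym l(W) = E[X W] with X in L^Uhat, hence X is in C**.
   Minimizing V(W) + (B + X) W pointwise over finitely many rationals at a time
   exchanges infimum and expectation, so that I_U(B + X) >= u(B) + e,
   contradicting the definition of u(B). *)

Require Import Defs.
From HB Require Import structures.
From mathcomp Require Import all_boot all_order all_algebra.
From mathcomp Require Import all_classical all_reals all_analysis.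
From mathcomp Require Import measurable_realfun ring lra.

Set Implicit Arguments.
Unset Strict Implicit.
Unset Printing Implicit Defensive.

Import Order.TTheory GRing.Theory Num.Theory.
Import numFieldNormedType.Exports.

Local Open Scope classical_set_scope.
Local Open Scope ring_scope.

(** * Sublinear functionals *)

(** The terms Z_n are what makes the separation possible: a gap of J above u(B) on a whole norm ball
    around the polar cone yields the Lipschitz constant K, hence a bounded l, whereas a gap on the
    cone alone would give no control of l. Finiteness of Vhat matters because otherwise the heart
    reduces to null variables; on the heart, dominated convergence of Vhat(X_n / c) has an
    integrable majorant at every scale c, so pointwise dominated convergence implies norm
    convergence. The density X is at first only integrable, so l(W) = E[X W] is available for
    bounded W only; these suffice to show that X lies in L^Uhat, after which Young's inequality
    extends the formula to the whole heart. For the same reason the interchange formula is tested on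
    bounded variables: a measurable minimizer over all y may fail to exist or to lie in the heart.
    The separating X is found in the bipolar and not in C, which is where the equality of the two
    suprema enters. *)

Section Sublinear.
Context {R : realType} {E : lmodType R}.
Implicit Types (D : set E) (q : E -> R) (A : set (E * R)) (x y : E).

(** Functionals are total on [E] and constrained on [D] only: the heart is a set of functions,
    without a module type of its own. *)
Definition linear_subspace D : Prop :=
  [/\ D 0, forall x y, D x -> D y -> D (x + y) &
      forall (c : R) x, D x -> D (c *: x)].

Definition sublinear_on D q : Prop :=
  (forall x y, D x -> D y -> q (x + y) <= q x + q y) /\
  (forall (c : R) x, 0 < c -> D x -> q (c *: x) <= c * q x).

Definition linear_on D q : Prop :=
  (forall x y, D x -> D y -> q (x + y) = q x + q y) /\
  (forall (c : R) x, D x -> q (c *: x) = c * q x).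

(** A convex cone in the hypograph of [q]; its elements are read as constraints [a.2 <= l a.1] on a
    linear functional [l]. *)
Definition cone_below D q A : Prop :=
  [/\ A (0, 0), forall a b, A a -> A b -> A (a.1 + b.1, a.2 + b.2),
      forall (c : R) a, 0 < c -> A a -> A (c *: a.1, c * a.2) &
      forall a, A a -> D a.1 /\ a.2 <= q a.1].

Variable D : set E.
Hypothesis DS : linear_subspace D.

Lemma subspace0 : D 0. Proof. by case: DS. Qed.

Lemma subspaceD x y : D x -> D y -> D (x + y).
Proof. by case: DS => _ + _; exact. Qed.

Lemma subspaceZ (c : R) x : D x -> D (c *: x).
Proof. by case: DS => _ _; exact. Qed.

Lemma subspaceN x : D x -> D (- x).
Proof. by move=> Dx; rewrite -scaleN1r; exact: subspaceZ. Qed.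

Lemma sublinear0 q : sublinear_on D q -> q 0 = 0.
Proof.
move=> [qD qZ]; have D0 := subspace0.
have := qD _ _ D0 D0; rewrite addr0 => ?.
have h : (0 : R) < 2^-1 by lra.
have := qZ _ _ h D0; rewrite scaler0 => ?; lra.
Qed.

Lemma sublinearZ q (c : R) x : sublinear_on D q -> 0 <= c -> D x ->
  q (c *: x) = c * q x.
Proof.
move=> qS; rewrite le_eqVlt => /predU1P[<- Dx|c0 Dx].
  by rewrite scale0r mul0r sublinear0.
case: qS => _ qZ; apply/eqP; rewrite eq_le qZ//=.
have ci0 : 0 < c^-1 by rewrite invr_gt0.
have := qZ _ _ ci0 (subspaceZ c Dx); rewrite scalerA mulVf ?gt_eqF// scale1r.
by rewrite ler_pdivlMl.
Qed.

Lemma sublinear_opp_ge0 q x : sublinear_on D q -> D x -> 0 <= q x + q (- x).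
Proof.
move=> qS Dx; rewrite -(sublinear0 qS) -(subrr x); apply qS.1 => //.
exact: subspaceN.
Qed.

(** For [A] a cone below [q], a linear [l] lies below this functional on [D] if and only if [l <= q]
    on [D] and [a.2 <= l a.1] on [A]. *)
Definition cone_inf q A (x : E) : R := inf [set q (x + a.1) - a.2 | a in A].

Section ConeInf.
Variables (q : E -> R) (A : set (E * R)).
Hypotheses (qS : sublinear_on D q) (Aq : cone_below D q A).

(** Combine [a.2 <= q a.1] with [q a.1 <= q (x + a.1) + q (- x)]. Without a lower bound [inf] would
    take its default value 0. *)
Lemma cone_inf_lbound x : D x ->
  lbound [set q (x + a.1) - a.2 | a in A] (- q (- x)).
Proof.
case: Aq => _ _ _ Aq' Dx _ [a Aa <-]; have [Da aq] := Aq' _ Aa.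
have := qS.1 _ _ (subspaceD Dx Da) (subspaceN Dx).
by rewrite addrAC subrr add0r => ?; lra.
Qed.

Lemma cone_inf_le x a : D x -> A a -> cone_inf q A x <= q (x + a.1) - a.2.
Proof.
move=> Dx Aa; apply: ge_inf; last by exists a.
by exists (- q (- x)); exact: cone_inf_lbound.
Qed.

Lemma le_cone_inf x z : (forall a, A a -> z <= q (x + a.1) - a.2) ->
  z <= cone_inf q A x.
Proof.
move=> zA; apply: lb_le_inf; last by move=> _ [a Aa <-]; exact: zA.
by case: Aq => A0 _ _ _; eexists; exists (0, 0) => //.
Qed.

Lemma cone_inf_le_id x : D x -> cone_inf q A x <= q x.
Proof.
case: Aq => A0 _ _ _ Dx; have /= := cone_inf_le Dx A0.
by rewrite addr0 subr0.
Qed.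

Lemma sublinear_cone_inf : sublinear_on D (cone_inf q A).
Proof.
case: Aq => A0 AD AZ Aq'; split=> [x y Dx Dy|c x c0 Dx].
  rewrite -lerBlDr; apply: le_cone_inf => a Aa; rewrite lerBlDr -lerBlDl.
  apply: le_cone_inf => b Ab; rewrite lerBlDl.
  have /= := cone_inf_le (subspaceD Dx Dy) (AD _ _ Aa Ab).
  have := qS.1 _ _ (subspaceD Dx (Aq' _ Aa).1) (subspaceD Dy (Aq' _ Ab).1).
  by rewrite addrACA => ? ?; lra.
rewrite -ler_pdivrMl//; apply: le_cone_inf => a Aa; rewrite ler_pdivrMl//.
have /= := cone_inf_le (subspaceZ c Dx) (AZ _ _ c0 Aa).
rewrite -scalerDr (sublinearZ qS (ltW c0) (subspaceD Dx (Aq' _ Aa).1)) => ?; lra.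
Qed.

End ConeInf.

Lemma minimal_sublinear_linear q : sublinear_on D q ->
  (forall p, sublinear_on D p -> (forall x, D x -> p x <= q x) ->
     forall x, D x -> q x <= p x) ->
  linear_on D q.
Proof.
move=> qS qmin.
have qD x h : D x -> D h -> q (x + h) = q x + q h.
  move=> Dx Dh; apply/eqP; rewrite eq_le qS.1//=.
  (* By minimality, inf_(t >= 0) (q (x + t h) - t q h) is still [q x]. *)
  pose A := [set a : E * R | exists2 t, 0 <= t & a = (t *: h, t * q h)].
  have Aq : cone_below D q A.
    split.
    - by exists 0 => //; rewrite scale0r mul0r.
    - move=> _ _ [s s0 ->] [t t0 ->]; exists (s + t); first exact: addr_ge0.
      by rewrite scalerDl mulrDl.
    - move=> c _ c0 [t t0 ->]; exists (c * t); first by rewrite mulr_ge0// ltW.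
      by rewrite scalerA mulrA.
    - move=> _ [t t0 ->] /=; split; first exact: subspaceZ.
      by rewrite (sublinearZ qS).
  have A1 : A (h, q h) by exists 1 => //; rewrite scale1r mul1r.
  have := qmin _ (sublinear_cone_inf qS Aq) (cone_inf_le_id qS Aq) _ Dx.
  by have /= := cone_inf_le qS Aq Dx A1; lra.
have qN x : D x -> q (- x) = - q x.
  move=> Dx; have := qD _ _ Dx (subspaceN Dx).
  by rewrite subrr (sublinear0 qS) => ?; lra.
split=> [|c x Dx]; first exact: qD.
have [c0|c0] := leP 0 c; first exact: sublinearZ.
rewrite -[c]opprK scaleNr qN; last exact: subspaceZ.
by rewrite (sublinearZ qS _ Dx) ?mulNr ?opprK// oppr_ge0 ltW.
Qed.

(** Zorn's lemma gives a minimal sublinear functional below [p], which is linear. Only a preorder is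
    available, since functionals that agree on [D] may differ elsewhere. *)
Lemma hahn_banach p : sublinear_on D p ->
  exists2 l, linear_on D l & forall x, D x -> l x <= p x.
Proof.
move=> pS.
pose T := {q | sublinear_on D q /\ forall x, D x -> q x <= p x}.
pose below (f g : T) := `[< forall x, D x -> sval g x <= sval f x >].
have p0 : sublinear_on D p /\ forall x, D x -> p x <= p x by split.
have [||A totA|f fmax] := @ZL_preorder T (exist _ p p0) below.
- by move=> f; apply/asboolP.
- move=> f g h /asboolP fg /asboolP gh; apply/asboolP => x Dx.
  exact: le_trans (gh _ Dx) (fg _ Dx).
- have [[f0 Af0]|A0] := pselect (exists f, A f); last first.
    by exists (exist _ p p0) => f Af; exfalso; apply: A0; exists f.
  pose S x := [set sval f x | f in A].
  have lbS x : D x -> lbound (S x) (- p (- x)).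
    move=> Dx _ [f Af <-]; case: f Af => f [fS fp] Af /=.
    have := fp _ (subspaceN Dx).
    by have := sublinear_opp_ge0 fS Dx; lra.
  have infle x f : D x -> A f -> inf (S x) <= sval f x.
    by move=> Dx Af; apply: ge_inf; [exists (- p (- x)); exact: lbS|exists f].
  have leinf x z : (forall f, A f -> z <= sval f x) -> z <= inf (S x).
    move=> zA; apply: lb_le_inf; first by eexists; exists f0.
    by move=> _ [f Af <-]; exact: zA.
  have gS : sublinear_on D (fun x => inf (S x)) /\
      forall x, D x -> inf (S x) <= p x.
    split; last first.
      by move=> x Dx; rewrite (le_trans (infle _ _ Dx Af0))// (svalP f0).2.
    split=> [x y Dx Dy|c x c0 Dx].
      rewrite -lerBlDr; apply: (leinf) => f Af; rewrite lerBlDr -lerBlDl.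
      apply: (leinf) => g Ag; rewrite lerBlDl.
      have Dxy := subspaceD Dx Dy.
      (* An infimum of sublinear functionals need not be subadditive; along a chain it is, as the
         smaller of [f] and [g] serves for both [x] and [y]. *)
      have [/asboolP fg|/asboolP gf] := totA _ _ Af Ag.
        have := infle _ _ Dxy Ag; have := (svalP g).1.1 _ _ Dx Dy.
        by have := fg _ Dx; lra.
      have := infle _ _ Dxy Af; have := (svalP f).1.1 _ _ Dx Dy.
      by have := gf _ Dy; lra.
    rewrite -ler_pdivrMl//; apply: (leinf) => f Af; rewrite ler_pdivrMl//.
    apply: le_trans (infle _ _ (subspaceZ c Dx) Af) _.
    exact: (svalP f).1.2.
  exists (exist _ (fun x => inf (S x)) gS) => f Af; apply/asboolP => x Dx /=.
  exact: infle.
exists (sval f); last exact: (svalP f).2.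
apply: minimal_sublinear_linear (svalP f).1 _ => q qS qf.
have qp : sublinear_on D q /\ forall x, D x -> q x <= p x.
  by split=> // x Dx; rewrite (le_trans (qf _ Dx))// (svalP f).2.
have /asboolP := fmax (exist _ q qp) (asboolT qf).
by move=> h x Dx; exact: h.
Qed.

(** Hahn-Banach below [cone_inf p A]; at [- a.1] it reads [- l a.1 <= p 0 - a.2]. *)
Lemma mazur_orlicz p A : sublinear_on D p -> cone_below D p A ->
  exists l, [/\ linear_on D l, forall x, D x -> l x <= p x &
                forall a, A a -> a.2 <= l a.1].
Proof.
move=> pS Ap.
have [l lL lp] := hahn_banach (sublinear_cone_inf pS Ap).
exists l; split=> // [x Dx|a Aa].
  exact: le_trans (lp _ Dx) (cone_inf_le_id pS Ap Dx).
have Da : D a.1 by case: Ap => _ _ _ /(_ _ Aa)[].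
have DNa := subspaceN Da.
have := le_trans (lp _ DNa) (cone_inf_le pS Ap DNa Aa).
rewrite addNr (sublinear0 pS) -scaleN1r lL.2// => ?; lra.
Qed.

End Sublinear.

(** * Utility functions and conjugates *)

Section Conjugate.
Context {R : realType}.
Implicit Types (f : R -> \bar R) (x y v w t : R).

Lemma conjugate_utility_ge f x y :
  (f x - (x * y)%:E <= conjugate_utility f y)%E.
Proof. by apply: ereal_sup_ubound; exists x. Qed.

Lemma conjugate_utility_leP f y v :
  (conjugate_utility f y <= v%:E)%E <-> forall x, (f x <= (v + x * y)%:E)%E.
Proof.
split=> [h x|h].
  by rewrite EFinD -leeBlDr//; exact: le_trans (conjugate_utility_ge _ _ _) h.
by apply: ge_ereal_sup => _ [x _ <-]; rewrite leeBlDr// -EFinD.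
Qed.

Lemma conjugate_utility_convex f t y z v w : 0 <= t <= 1 ->
  (conjugate_utility f y <= v%:E)%E -> (conjugate_utility f z <= w%:E)%E ->
  (conjugate_utility f (t * y + (1 - t) * z) <= (t * v + (1 - t) * w)%:E)%E.
Proof.
move=> /andP[t0 t1] /conjugate_utility_leP hy /conjugate_utility_leP hz.
apply/conjugate_utility_leP => x.
have := hy x; have := hz x.
case: (f x) => [r| |]; [|by rewrite (leNgt +oo%E) ltry|by rewrite !leNye].
rewrite !lee_fin => h1 h2.
have : t * r <= t * (v + x * y) by rewrite ler_wpM2l.
have : (1 - t) * r <= (1 - t) * (w + x * z) by rewrite ler_wpM2l// subr_ge0.
lra.
Qed.

Lemma conjugate_utility_convex_ereal f t y z :
  (forall y, (0 <= conjugate_utility f y)%E) -> 0 < t < 1 ->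
  (conjugate_utility f (t * y + (1 - t) * z) <=
   t%:E * conjugate_utility f y + (1 - t)%:E * conjugate_utility f z)%E.
Proof.
move=> f0 /andP[t0 t1].
have [t0' t1'] : (0 < t%:E)%E /\ (0 < (1 - t)%:E)%E.
  by rewrite !lte_fin subr_gt0.
move: (f0 y) (f0 z) (@conjugate_utility_convex f t y z).
case: (conjugate_utility f y) => [v| |] // v0;
  case: (conjugate_utility f z) => [w| |] // w0; move=> h.
- by rewrite -!EFinM -EFinD; apply: h => //; rewrite !ltW.
- by rewrite (gt0_muley t1') -EFinM addey// leey.
- by rewrite (gt0_muley t0') -EFinM addye// leey.
- by rewrite (gt0_muley t0') (gt0_muley t1') leey.
Qed.

(** A supremum of affine functions is lower semicontinuous: each strict superlevel set is a union
    over [x] of open sets. *)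
Lemma measurable_conjugate_utility f :
  measurable_fun [set: R] (conjugate_utility f).
Proof.
apply: lower_semicontinuous_measurable; apply/lower_semicontinuousP => a.
rewrite (_ : [set y | _] =
    \bigcup_x [set y | (a%:E < f x - (x * y)%:E)%E]); last first.
  apply/seteqP; split=> [y /=|y [x _ /=] /lt_le_trans]; last first.
    by apply; exact: conjugate_utility_ge.
  by move=> /ereal_sup_gt[_ [x _ <-] ax]; exists x.
apply: bigcup_open => x _; case: (f x) => [r| |].
- rewrite (_ : [set y | _] = (fun y => r - x * y) @^-1` [set z | a < z]).
    apply: open_comp => [y _|]; last exact: open_gt.
    apply: cvgB; first exact: cvg_cst.
    by apply: cvgM; [exact: cvg_cst|exact: cvg_id].
  by apply/seteqP; split=> y /=; rewrite -EFinB lte_fin.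
- rewrite (_ : [set y | _] = setT); first exact: openT.
  by apply/seteqP; split=> y //= _; rewrite addye// ltey.
- rewrite (_ : [set y | _] = set0); first exact: open0.
  by apply/seteqP; split=> y //=.
Qed.

End Conjugate.

Section UtilityFacts.
Context {R : realType}.
Variable U : R -> \bar R.
Hypothesis HU : utility U.
Implicit Types (x y r : R).

Local Notation V := (conjugate_utility U).
Local Notation Uhat := (young_utility U).
Local Notation Vhat := (conjugate_young_utility U).

Lemma utility_le0 x : x <= 0 -> (U x <= 0)%E.
Proof. by rewrite -(utility0 HU); exact: utility_nondecreasing. Qed.

Lemma utility_fin_num_ge x y : x <= y -> (-oo < U x)%E -> U y \is a fin_num.
Proof.
move=> xy Ux; rewrite fin_numElt (utility_lty HU) andbT.
exact: lt_le_trans Ux (utility_nondecreasing HU xy).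
Qed.

Lemma utility_neg_domain : exists2 x, x < 0 & (-oo < U x)%E.
Proof.
have /ereal_inf_lt[_ [x Ux <-]] := utility_lower_endpoint HU.
by rewrite lte_fin => x0; exists x.
Qed.

(** The chord-slope inequality of a concave function. Raising the value at [x] to [r] decreases the
    right slope and increases the left one, so the inequality survives. *)
Lemma utility_slope x r z z' : (U x <= r%:E)%E -> (-oo < U z)%E ->
  z < x -> x < z' ->
  (fine (U z') - r) / (z' - x) <= (r - fine (U z)) / (x - z).
Proof.
move=> Uxr Uz zx xz'.
have Fz := utility_fin_num_ge (lexx z) Uz.
have Fx := utility_fin_num_ge (ltW zx) Uz.
have Fz' := utility_fin_num_ge (ltW (lt_trans zx xz')) Uz.
pose t := (z' - x) / (z' - z).
have zz' : 0 < z' - z by rewrite subr_gt0 (lt_trans zx).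
have t0 : 0 < t by rewrite divr_gt0// subr_gt0.
have t1 : t < 1 by rewrite ltr_pdivrMr// mul1r; lra.
have tx : t * z + (1 - t) * z' = x by rewrite /t; field; rewrite gt_eqF.
have := utility_concave HU z z' t0 t1; rewrite tx.
rewrite -(fineK Fz) -(fineK Fz') -!EFinM -EFinD => /le_trans/(_ Uxr).
rewrite lee_fin => h.
rewrite ler_pdivrMr ?subr_gt0// mulrAC ler_pdivlMr ?subr_gt0//.
have : (t * fine (U z) + (1 - t) * fine (U z')) * (z' - z) <= r * (z' - z).
  by rewrite ler_pM2r.
have -> : (t * fine (U z) + (1 - t) * fine (U z')) * (z' - z) =
    (z' - x) * fine (U z) + (x - z) * fine (U z').
  by rewrite /t; field; rewrite gt_eqF.
lra.
Qed.

(** The slope [y] is the supremum of the slopes of chords from [(x, r)] to the right. A domain point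
    left of [x] makes it finite, and the chord-slope inequality puts the line of slope [y] through
    [(x, r)] above the graph on both sides. *)
Lemma utility_supergradient x r z : (U x <= r%:E)%E -> (-oo < U z)%E ->
  z < x -> exists y, (V y <= (r - x * y)%:E)%E.
Proof.
move=> Uxr Uz zx.
have slope := utility_slope Uxr.
pose A := [set (fine (U z') - r) / (z' - x) | z' in [set z' | x < z']].
have A0 : A !=set0.
  by exists ((fine (U (x + 1)) - r) / (x + 1 - x)); exists (x + 1) => //=; lra.
have ubA z1 : z1 < x -> (-oo < U z1)%E ->
    ubound A ((r - fine (U z1)) / (x - z1)).
  by move=> z1x Uz1 _ [z' /= xz' <-]; exact: slope.
have supA : has_sup A by split=> //; eexists; exact: ubA zx Uz.
exists (sup A); apply/conjugate_utility_leP => x'.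
have [x'x|xx'|->] := ltgtP x' x; last by rewrite subrK.
- have [Ux'|] := boolP (-oo < U x')%E; last first.
    by rewrite -leNgt leeNy_eq => /eqP ->; exact: leNye.
  have := ge_sup A0 (ubA _ x'x Ux').
  rewrite ler_pdivlMr ?subr_gt0// -(fineK (utility_fin_num_ge (lexx _) Ux')).
  by rewrite lee_fin => ?; lra.
- have Ax' : A ((fine (U x') - r) / (x' - x)) by exists x'.
  have := ub_le_sup supA.2 Ax'.
  have zx' : z <= x' by lra.
  rewrite ler_pdivrMr ?subr_gt0// -(fineK (utility_fin_num_ge zx' Uz)).
  by rewrite lee_fin => ?; lra.
Qed.

Lemma utility_linear_bound : exists b, forall x, (U x <= (x * b)%:E)%E.
Proof.
have [z z0 Uz] := utility_neg_domain.
have U0 : (U 0 <= 0%:E)%E by rewrite (utility0 HU).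
have [b] := utility_supergradient U0 Uz z0.
rewrite mul0r subr0 => /conjugate_utility_leP h.
by exists b => x; have := h x; rewrite add0r.
Qed.

(** Fenchel-Moreau: [U] is the infimum of its affine majorants. The strict inequality is spent on
    upper semicontinuity when [x] has no domain point to its left. *)
Lemma utility_biconjugate_le x r : (U x < r%:E)%E ->
  exists y, (V y <= (r - x * y)%:E)%E.
Proof.
move=> Uxr.
have [[z [zx Uz]]|noz] := pselect (exists z, z < x /\ (-oo < U z)%E).
  exact: utility_supergradient (ltW Uxr) Uz zx.
(* [U = -oo] on the left of [x]: upper semicontinuity bounds [U] by [r] just
   to the right of [x], and a steep slope takes care of the rest. *)
have Uz z : z < x -> U z = -oo%E.
  move=> zx; apply/eqP; rewrite -leeNy_eq leNgt; apply/negP => Uz.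
  by apply: noz; exists z.
have [b hb] := utility_linear_bound.
have : ((- r)%:E < - U x)%E by rewrite EFinN lteN2.
move=> /(utility_usc HU)[W /= /nbhs_ballP[e /= e0 xe] WU].
have {xe WU} Ue x' : x <= x' < x + e -> (U x' < r%:E)%E.
  move=> /andP[xx' x'e]; rewrite -lteN2 -EFinN; apply: WU; apply: xe.
  rewrite /ball/= ltr_norml; lra.
(* At distance at least [e] to the right of [x], an extra slope [c] makes up for the difference
   between [x * b] and [r], so the line through [(x, r)] overtakes the linear bound of slope [b]. *)
pose c := `|x * b - r| / e.
have c0 : 0 <= c by rewrite divr_ge0// ltW.
exists (Num.max 0 (b + c)); apply/conjugate_utility_leP => x'.
set y := Num.max _ _.
have y0 : 0 <= y by rewrite le_max lexx.
have yb : b + c <= y by rewrite le_max lexx orbT.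
have [x'x|xx'] := ltP x' x; first by rewrite Uz// leNye.
have y0' : 0 <= (x' - x) * y by rewrite mulr_ge0// subr_ge0.
have [x'e|ex'] := ltP x' (x + e).
  apply: (@le_trans _ _ r%:E); last by rewrite lee_fin; lra.
  by apply/ltW/Ue; rewrite xx'.
apply: le_trans (hb x') _; rewrite lee_fin.
have : (x' - x) * (b + c) <= (x' - x) * y by rewrite ler_wpM2l// subr_ge0.
have : `|x * b - r| <= (x' - x) * c.
  rewrite /c mulrA ler_pdivlMr// mulrC ler_wpM2r//; lra.
have := ler_norm (x * b - r); lra.
Qed.

Lemma conjugate_utility_ge0 y : (0 <= V y)%E.
Proof.
have := conjugate_utility_ge U 0 y.
by rewrite (utility0 HU) mul0r sube0.
Qed.

Lemma utility_fenchel x y v : (V y <= v%:E)%E -> (U x <= (v + x * y)%:E)%E.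
Proof. by move=> /conjugate_utility_leP. Qed.

Lemma young_utility_ge0 x : (0 <= Uhat x)%E.
Proof. by rewrite /young_utility oppe_ge0 utility_le0// oppr_le0. Qed.

(** The substitution of [- x] for [x] makes Vhat a conjugate in the sense of [conjugate_utility], so
    that convexity and measurability carry over. *)
Lemma conjugate_young_utilityE :
  Vhat = conjugate_utility (fun x => U (- `|x|)).
Proof.
apply/funext => y; congr ereal_sup; apply/seteqP; split=> _ [x _ <-];
  exists (- x) => //; rewrite /young_utility normrN.
  by rewrite oppeK mulNr EFinN oppeK addeC.
by rewrite oppeK mulNr EFinN addeC.
Qed.

Lemma conjugate_young_utility_ge0 y : (0 <= Vhat y)%E.
Proof.
rewrite conjugate_young_utilityE.
have := conjugate_utility_ge (fun x => U (- `|x|)) 0 y.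
by rewrite normr0 oppr0 (utility0 HU) mul0r sube0.
Qed.

Lemma young_fenchel x y : ((x * y)%:E <= Uhat x + Vhat y)%E.
Proof.
have [Ux|] := boolP (Uhat x \is a fin_num).
  by rewrite addeC -leeBlDr//; apply: ereal_sup_ubound; exists x.
rewrite ge0_fin_numE ?young_utility_ge0// -leNgt leye_eq => /eqP ->.
by rewrite addye ?leey// -ltNye (lt_le_trans _ (conjugate_young_utility_ge0 y)).
Qed.

Lemma conjugate_young_utility0 : Vhat 0 = 0%E.
Proof.
apply/eqP; rewrite eq_le conjugate_young_utility_ge0 andbT.
apply: ge_ereal_sup => _ [x _ <-].
by rewrite mulr0 sub0e oppe_le0 young_utility_ge0.
Qed.

Lemma conjugate_young_utilityN y : Vhat (- y) = Vhat y.
Proof.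
congr ereal_sup; apply/seteqP; split=> _ [x _ <-]; exists (- x) => //.
  by rewrite /young_utility normrN mulrN mulNr.
by rewrite /young_utility normrN mulrNN.
Qed.

(** This lets the Vhat-modular, and hence the norm, be controlled by I_V. Terms with [x * y >= 0]
    are nonpositive; the others are compared with the term of [V] at the same [x]. *)
Lemma conjugate_young_utility_le y : (Vhat y <= V y)%E.
Proof.
rewrite conjugate_young_utilityE; apply: ge_ereal_sup => _ [x _ <-].
have Ux : (U (- `|x|) <= 0)%E by rewrite utility_le0// oppr_le0.
have [xy|xy] := leP 0 (x * y).
  apply: le_trans (conjugate_utility_ge0 y).
  by rewrite leeBlDr// add0e (le_trans Ux)// lee_fin.
have [x0|x0] := ltP x 0.
  have := conjugate_utility_ge U x y.
  by rewrite (ltr0_norm x0) opprK.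
have := conjugate_utility_ge U x y; apply: le_trans.
by rewrite leeB// (utility_nondecreasing HU)// (le_trans _ x0)// oppr_le0.
Qed.

Hypothesis Uinf : superlinear_at_ninfty U.

(** The one direct use of superlinearity: beyond some [M] the loss [- U (- |x|)] exceeds [|x| |y|],
    so only [|x| <= M] contributes, by at most [M |y|]. *)
Lemma conjugate_young_utility_lty y : (Vhat y < +oo)%E.
Proof.
rewrite conjugate_young_utilityE.
have /cvgeyPge/(_ `|y|)[A [Areal AU]] := Uinf.
pose M := Num.max 1 (- A + 1).
have M0 : 0 < M by rewrite lt_max ltr01.
apply: (@le_lt_trans _ _ (M * `|y|)%:E); last exact: ltey.
apply/conjugate_utility_leP => x.
have hxy : - (x * y) <= `|x| * `|y| by rewrite -normrM -normrN ler_norm.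
have [xM|Mx] := leP `|x| M.
  apply: (@le_trans _ _ 0%E); first by rewrite utility_le0// oppr_le0.
  rewrite lee_fin; have : `|x| * `|y| <= M * `|y| by rewrite ler_wpM2r.
  lra.
have x0 : 0 < `|x| by rewrite (lt_trans M0).
have : - `|x| < A by move: Mx; rewrite gt_max => /andP[_]; lra.
move=> /AU; have := utility_lty HU (- `|x|).
case: (U (- `|x|)) => [r| |]//.
  move=> _; rewrite -EFinM !lee_fin invrN mulrN -mulNr ler_pdivlMr//.
  have : 0 <= M * `|y| by rewrite mulr_ge0// ltW.
  by move=> ? ?; lra.
by rewrite leNye.
Qed.

(** Above the slope of a linear majorant of [U], the terms with [x >= 0] are nonpositive, and those
    with [x < 0] are terms of the finite Vhat. *)
Lemma conjugate_utility_finite_ray : exists b, forall y, b <= y -> (V y < +oo)%E.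
Proof.
have [b hb] := utility_linear_bound; exists (Num.max b 0) => y.
rewrite ge_max => /andP[by_ y0].
apply: le_lt_trans (conjugate_young_utility_lty y).
apply: ge_ereal_sup => _ [x _ <-].
have [x0|x0] := leP 0 x.
  apply: le_trans (conjugate_young_utility_ge0 y).
  rewrite leeBlDr// add0e (le_trans (hb x))// lee_fin ler_wpM2l//.
rewrite conjugate_young_utilityE.
have := conjugate_utility_ge (fun x => U (- `|x|)) x y.
by rewrite (ltr0_norm x0) opprK.
Qed.

End UtilityFacts.

(** * Interchange of infimum and expectation *)

Section Interchange.
Context {d : measure_display} {Omega : measurableType d} {R : realType}.
Variables (P : probability Omega R) (U : R -> \bar R).
Hypotheses (HU : utility U) (Uinf : superlinear_at_ninfty U).
Implicit Types (x y r : R).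

Local Notation V := (conjugate_utility U).

Lemma utility_biconjugate_rat x r : (U x < r%:E)%E ->
  exists q : rat, (V (ratr q) + (x * ratr q)%:E < r%:E)%E.
Proof.
move=> Uxr.
have [s Uxs sr] : exists2 s, (U x < s%:E)%E & s < r.
  case: (U x) (utility_lty HU x) Uxr => [u| |]// _.
    rewrite lte_fin => ur; exists ((u + r) / 2); last by lra.
    by rewrite lte_fin; lra.
  by exists (r - 1); rewrite ?ltNyr//; lra.
(* [V] may be infinite on one side of [y], so approach [y] by rationals from
   within the segment to another point [z] of the domain of [V]. *)
have [y Vy] := utility_biconjugate_le HU Uxs.
have [b hb] := conjugate_utility_finite_ray HU Uinf.
pose z := Num.max b (y + 1).
have yz : y < z by rewrite lt_max; apply/orP; right; lra.
have Fz : V z \is a fin_num.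
  by rewrite ge0_fin_numE ?conjugate_utility_ge0// hb// le_max lexx.
(* [M] is the dual cost at [z]. At a fraction [t] of the way from [y] to [z] the cost is at most
   [s + t (M - s)], which is below [r] once [t < e]; the 1 in [e] covers [M = s]. *)
pose M := fine (V z) + x * z.
pose e := (r - s) / (`|M - s| + 1).
have e0 : 0 < e by rewrite divr_gt0 ?subr_gt0// ltr_pwDr.
pose t0 := Num.min 1 e.
have t00 : 0 < t0 by rewrite lt_min ltr01.
have : y < y + t0 * (z - y) by rewrite ltrDl mulr_gt0// subr_gt0.
move=> /rat_in_itvoo[q]; rewrite in_itv/= => /andP[yq qz].
exists q.
pose t := (ratr q - y) / (z - y).
have zy0 : 0 < z - y by rewrite subr_gt0.
have t_gt0 : 0 < t by rewrite divr_gt0// subr_gt0.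
have t_lt : t < t0 by rewrite ltr_pdivrMr//; lra.
have [t1 te] : t < 1 /\ t < e by move: t_lt; rewrite lt_min => /andP[].
have qE : t * z + (1 - t) * y = ratr q by rewrite /t; field; rewrite gt_eqF.
have t01 : 0 <= t <= 1 by rewrite !ltW.
have Vz : (V z <= (fine (V z))%:E)%E by rewrite fineK.
have := conjugate_utility_convex t01 Vz Vy; rewrite qE => Vq.
apply: (le_lt_trans (leeD2r _ Vq)); rewrite -EFinD lte_fin -qE.
have : t * (`|M - s| + 1) < r - s by rewrite -ltr_pdivlMr// ltr_pwDr.
have : t * (M - s) <= t * `|M - s| by rewrite ler_wpM2l ?ler_norm// ltW.
rewrite /M; lra.
Qed.

(** Rationals at which [V] is infinite are replaced by the point [b], so that every cost along the
    sequence is a real number. *)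
Lemma utility_biconjugate_seq : exists2 q : nat -> R,
  forall i, (V (q i) < +oo)%E &
  forall x r, (U x < r%:E)%E ->
    exists i, (V (q i) + (x * q i)%:E < r%:E)%E.
Proof.
have [b hb] := conjugate_utility_finite_ray HU Uinf.
pose p i : R := ratr (odflt 0 (unpickle i)).
exists (fun i => if (V (p i) < +oo)%E then p i else b) => [i|x r Uxr].
  by case: ifPn => // _; exact: hb.
have [q Vq] := utility_biconjugate_rat Uxr.
have Voo : (V (ratr q) < +oo)%E.
  by rewrite ltey; apply: contraTneq Vq => ->; rewrite addye.
by exists (pickle q); rewrite /p pickleK /= Voo.
Qed.

Section Selection.
Variable q : nat -> R.
Hypothesis qV : forall i, (V (q i) < +oo)%E.

Definition dual_cost y x : R := fine (V y) + x * y.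

(** A minimizer of the cost over [q 0], ..., [q n] only: having finitely many values, it yields
    bounded measurable variables without any selection theorem. *)
Fixpoint dual_argmin n x : R :=
  if n is n'.+1 then
    if dual_cost (q n'.+1) x < dual_cost (dual_argmin n' x) x then q n'.+1
    else dual_argmin n' x
  else q 0.

Lemma dual_argmin_lty n x : (V (dual_argmin n x) < +oo)%E.
Proof. by elim: n => //= n ih; case: ifP. Qed.

Lemma dual_argmin_bounded n : exists C, forall x,
  `|dual_argmin n x| <= C /\ fine (V (dual_argmin n x)) <= C.
Proof.
elim: n => [|n [C ih]] /=.
  by exists (Num.max `|q 0| (fine (V (q 0)))) => x; rewrite !le_max !lexx orbT.
exists (Num.max C (Num.max `|q n.+1| (fine (V (q n.+1))))) => x.
case: ifP => _; first by rewrite !le_max !lexx !orbT.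
by have [h1 h2] := ih x; rewrite !le_max h1 h2.
Qed.

Lemma dual_cost_nonincreasing n x :
  dual_cost (dual_argmin n.+1 x) x <= dual_cost (dual_argmin n x) x.
Proof. by rewrite /=; case: ifPn => // /ltW. Qed.

Lemma dual_cost_argmin_le n x : dual_cost (dual_argmin n x) x <= dual_cost (q n) x.
Proof. by case: n => //= n; case: ifPn => //; rewrite -leNgt. Qed.

Lemma measurable_fine_conjugate_utility :
  measurable_fun [set: R] (fine \o V).
Proof.
apply: measurableT_comp; first exact: fine_measurable.
exact: measurable_conjugate_utility.
Qed.

Lemma measurable_dual_argmin n : measurable_fun [set: R] (dual_argmin n).
Proof.
elim: n => [|n ih] /=; first exact: measurable_cst.
apply: measurable_fun_ifT => //; apply: measurable_fun_ltr.
  apply: measurable_funD; first exact: measurable_cst.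
  by apply: measurable_funM => //; exact: measurable_id.
apply: measurable_funD.
  exact: (measurableT_comp measurable_fine_conjugate_utility ih).
by apply: measurable_funM => //; exact: measurable_id.
Qed.

Lemma utility_le_dual_cost y x : (V y < +oo)%E -> (U x <= (dual_cost y x)%:E)%E.
Proof.
move=> Vy; apply: utility_fenchel.
by rewrite fineK// ge0_fin_numE ?conjugate_utility_ge0.
Qed.

End Selection.

Lemma measurable_utility : measurable_fun [set: R] U.
Proof.
have := lower_semicontinuous_measurable (utility_usc HU) => h.
have -> : U = -%E \o (fun x => - U x)%E by apply/funext => x /=; rewrite oppeK.
exact: measurableT_comp.
Qed.

(** The costs [G n] of the minimizers decrease pointwise to [U (xi w)], and each has expectation at
    least [r]. Monotone convergence is applied to the nonnegative differences [D n] from [G 0]. *)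
Lemma conjugate_interchange (xi : Omega -> R) r :
  P.-integrable [set: Omega] (EFin \o xi) ->
  (forall (W : Omega -> R) (C : R), measurable_fun [set: Omega] W ->
     (forall w, `|W w| <= C /\ (V (W w) <= C%:E)%E) ->
     (r%:E <= \int[P]_w (V (W w) + (xi w * W w)%:E))%E) ->
  (r%:E <= integral_functional P U xi)%E.
Proof.
move=> xi_int H.
have mxi : measurable_fun [set: Omega] xi.
  by apply/measurable_EFinP; exact: measurable_int xi_int.
have [q qV qU] := utility_biconjugate_seq.
pose W n w := dual_argmin q n (xi w).
pose G n w := dual_cost (W n w) (xi w).
have mW n : measurable_fun [set: Omega] (W n).
  exact: measurableT_comp (measurable_dual_argmin q n) mxi.
have FV n w : V (W n w) \is a fin_num.
  by rewrite ge0_fin_numE ?conjugate_utility_ge0// dual_argmin_lty.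
have mG n : measurable_fun [set: Omega] (G n).
  apply: measurable_funD; last exact: measurable_funM.
  exact: (measurableT_comp measurable_fine_conjugate_utility (mW n)).
have GE n w : (V (W n w) + (xi w * W n w)%:E)%E = (G n w)%:E.
  by rewrite /G /dual_cost EFinD fineK.
have iG n : P.-integrable [set: Omega] (EFin \o G n).
  have [C hC] := dual_argmin_bounded q n.
  apply: (@le_integrable _ _ _ P _ measurableT _
      (fun w => C%:E + C%:E * `|(xi w)%:E|)%E).
  - exact/measurable_EFinP.
  - move=> w _; rewrite /G /dual_cost -/(W n w).
    have [h1 h2] := hC (xi w).
    have C0 : 0 <= C by exact: le_trans h1.
    rewrite -EFinM -EFinD /comp lee_fin (@ger0_norm _ (C + _)); last first.
      by rewrite addr_ge0// mulr_ge0.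
    apply: le_trans (ler_normD _ _) _; apply: lerD.
      by rewrite ger0_norm// fine_ge0// conjugate_utility_ge0.
    by rewrite normrM mulrC ler_wpM2r.
  - apply: integrableD => //.
      exact: (finite_measure_integrable_cst P C measurableT).
    by apply: integrableZl => //; exact: integrable_abse.
have rG n : (r%:E <= \int[P]_w (G n w)%:E)%E.
  have [C hC] := dual_argmin_bounded q n.
  under eq_integral do rewrite -GE.
  apply: (H (W n) C) => // w; have [h1 h2] := hC (xi w).
  by split=> //; rewrite -(fineK (FV n w)) lee_fin.
have Gn0 n w : G n w <= G 0%N w.
  by elim: n => // n; apply: le_trans; exact: dual_cost_nonincreasing.
pose D n w : \bar R := (G 0%N w - G n w)%:E.
have D0 n w : (0 <= D n w)%E by rewrite lee_fin subr_ge0.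
have ndD w : {homo D ^~ w : m n / (m <= n)%N >-> (m <= n)%E}.
  apply/nondecreasing_seqP => n; rewrite lee_fin lerB//.
  exact: dual_cost_nonincreasing.
have mD n : measurable_fun [set: Omega] (D n).
  by apply/measurable_EFinP; exact: measurable_funB.
pose L w : \bar R := ereal_sup (range (D ^~ w)).
have cvgD w : D ^~ w @ \oo --> L w.
  exact: ereal_nondecreasing_cvgn (ndD w).
have DL n w : (D n w <= L w)%E by apply: ereal_sup_ubound; exists n.
have intD n : (\int[P]_w D n w <= \int[P]_w (G 0%N w)%:E - r%:E)%E.
  rewrite /D; under eq_integral do rewrite EFinB.
  by rewrite integralB_EFin//; apply: leeB.
have L0 w : (0 <= L w)%E by apply: le_trans (DL 0%N w).
have mL : measurable_fun [set: Omega] L.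
  exact: (@emeasurable_fun_cvg _ _ _ setT D L mD (fun w _ => cvgD w)).
have intL : (\int[P]_w L w <= \int[P]_w (G 0%N w)%:E - r%:E)%E.
  have -> : L = fun w => limn (D ^~ w).
    by apply/funext => w; apply/esym/cvg_lim => //; exact: cvgD.
  rewrite (@monotone_convergence _ _ _ P _ measurableT D mD)//.
  have nd_int : nondecreasing_seq (fun n => \int[P]_w D n w)%E.
    by move=> m n mn; apply: ge0_le_integral => // w _; exact: ndD.
  rewrite (cvg_lim _ (ereal_nondecreasing_cvgn nd_int))//.
  by apply: ge_ereal_sup => _ [n _ <-]; exact: intD.
(* The uniform lower bound [r] makes the limit integrable, so that the expectation of [G 0 - L]
   splits below. *)
have iL : P.-integrable [set: Omega] L.
  apply/integrableP; split=> //.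
  under eq_integral do rewrite gee0_abs//.
  apply: le_lt_trans intL _.
  by rewrite -(fineK (integrable_fin_num measurableT (iG 0%N))) -EFinB ltry.
(* Fenchel's inequality bounds [U (xi w)] by every [G n w]. If it were below their limit, some [q i]
   would have a cost below that limit too, yet [G i w] is at most this cost. *)
have UE w : U (xi w) = ((G 0%N w)%:E - L w)%E.
  have UG n : (U (xi w) <= (G n w)%:E)%E.
    exact: utility_le_dual_cost (dual_argmin_lty qV n (xi w)).
  apply/eqP; rewrite eq_le; apply/andP; split.
    case Uw : (U (xi w)) (utility_lty HU (xi w)) => [u| |]//; last by rewrite leNye.
    move=> _.
    have : (L w <= (G 0%N w - u)%:E)%E.
      apply: ge_ereal_sup => _ [n _ <-]; rewrite lee_fin lerB//.
      by have := UG n; rewrite Uw lee_fin.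
    case: (L w) (L0 w) => [l|_|]; [|by rewrite leNgt ltry|by rewrite leNgt ltNy0].
    by rewrite -EFinB !lee_fin => _ ?; lra.
  rewrite leNgt; apply/negP => UGL.
  case Lw : (L w) (L0 w) UGL => [l| |];
    [|by rewrite addeNy ltNge leNye|by rewrite leNgt ltNy0].
  rewrite -EFinB => _ /qU[i].
  have -> : (V (q i) + (xi w * q i)%:E = (dual_cost (q i) (xi w))%:E)%E.
    by rewrite /dual_cost EFinD fineK// ge0_fin_numE ?conjugate_utility_ge0.
  rewrite lte_fin => qi.
  have := DL i w; rewrite Lw lee_fin.
  have := dual_cost_argmin_le q i (xi w); rewrite -/(W i w) -/(G i w); lra.
rewrite /integral_functional; under eq_integral do rewrite UE.
rewrite (integralB measurableT (iG 0%N) iL).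
have /fineK <- := integrable_fin_num measurableT iL.
have /fineK E0 := integrable_fin_num measurableT (iG 0%N).
move: intL; rewrite -(fineK (integrable_fin_num measurableT iL)) -E0.
by rewrite -!EFinB !lee_fin; lra.
Qed.

End Interchange.

(** * Orlicz hearts and their duals *)

(** The properties of Vhat from which the theory of its heart is derived; finiteness puts the
    constants into the heart. *)
Record finite_young {R : realType} (Phi : R -> \bar R) : Prop := {
  finite_young_ge0 : forall x, (0 <= Phi x)%E ;
  finite_young0 : Phi 0 = 0%E ;
  finite_young_lty : forall x, (Phi x < +oo)%E ;
  finite_youngN : forall x, Phi (- x)%R = Phi x ;
  finite_young_convex : forall t x y : R, 0 < t < 1 ->
    (Phi (t * x + (1 - t) * y)%R <= t%:E * Phi x + (1 - t)%:E * Phi y)%E ;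
  measurable_finite_young : measurable_fun [set: R] Phi
}.

Lemma integral_convex {d : measure_display} {Omega : measurableType d}
    {R : realType} (P : probability Omega R) (f : R -> \bar R) (t : R)
    (X Y : Omega -> R) :
  (forall x, (0 <= f x)%E) -> measurable_fun [set: R] f ->
  (forall t x y : R, 0 < t < 1 ->
    (f (t * x + (1 - t) * y)%R <= t%:E * f x + (1 - t)%:E * f y)%E) ->
  0 < t < 1 ->
  measurable_fun [set: Omega] X -> measurable_fun [set: Omega] Y ->
  (\int[P]_w f (t * X w + (1 - t) * Y w)%R <=
   t%:E * \int[P]_w f (X w) + (1 - t)%:E * \int[P]_w f (Y w))%E.
Proof.
move=> f0 mf fconv t01 mX mY; have /andP[t0 t1] := t01.
have mfX : measurable_fun [set: Omega] (f \o X) by exact: measurableT_comp.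
have mfY : measurable_fun [set: Omega] (f \o Y) by exact: measurableT_comp.
have t0' : (0 <= t%:E)%E by rewrite lee_fin ltW.
have t1' : (0 <= (1 - t)%:E)%E by rewrite lee_fin subr_ge0 ltW.
rewrite -!ge0_integralZl// -ge0_integralD//; last first.
- exact: measurable_funeM.
- by move=> w _; exact: mule_ge0.
- exact: measurable_funeM.
- by move=> w _; exact: mule_ge0.
apply: ge0_le_integral => //.
- apply: (measurableT_comp mf (g := fun w => t * X w + (1 - t) * Y w)).
  by apply: measurable_funD; apply: measurable_funM => //; exact: measurable_cst.
- by apply: emeasurable_funD; exact: measurable_funeM.
- by move=> w _; exact: fconv.
Qed.

Section OrliczHeart.
Context {d : measure_display} {Omega : measurableType d} {R : realType}.
Variables (P : probability Omega R) (Phi : R -> \bar R).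
Hypothesis HPhi : finite_young Phi.
Implicit Types (X Y : Omega -> R^o) (x y : R).

Local Notation heart := (orlicz_heart P Phi : set (Omega -> R^o)).
Local Notation lux := (luxemburg_norm P Phi).

Let Phi_ge0 := finite_young_ge0 HPhi.

Lemma finite_young_fin_num x : Phi x \is a fin_num.
Proof. by rewrite ge0_fin_numE// (finite_young_lty HPhi). Qed.

Lemma finite_young_scale t x : 0 <= t <= 1 -> (Phi (t * x)%R <= t%:E * Phi x)%E.
Proof.
move=> /andP[]; rewrite le_eqVlt => /predU1P[<- _|t0].
  by rewrite mul0r mul0e (finite_young0 HPhi).
rewrite le_eqVlt => /predU1P[->|t1]; first by rewrite mul1r mul1e.
have t01 : 0 < t < 1 by rewrite t0.
have := finite_young_convex HPhi x 0 t01.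
by rewrite mulr0 addr0 (finite_young0 HPhi) mule0 adde0.
Qed.

Lemma finite_young_norm x : Phi `|x| = Phi x.
Proof. by case: (ger0P x) => // _; rewrite (finite_youngN HPhi). Qed.

Lemma le_finite_young x y : `|x| <= `|y| -> (Phi x <= Phi y)%E.
Proof.
rewrite -(finite_young_norm x) -(finite_young_norm y).
have [->|y0] := eqVneq y 0.
  by rewrite normr0 normr_le0 => /eqP ->; rewrite normr0.
have {}y0 : 0 < `|y| by rewrite normr_gt0.
move=> xy; have t01 : 0 <= `|x| / `|y| <= 1.
  by rewrite divr_ge0//= ler_pdivrMr// mul1r.
have := finite_young_scale `|y| t01.
rewrite divfK ?gt_eqF// => /le_trans; apply.
by rewrite gee_pMl ?finite_young_fin_num// lee_fin; case/andP: t01.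
Qed.

Lemma measurable_finite_young_comp X : measurable_fun [set: Omega] X ->
  measurable_fun [set: Omega] (fun w => Phi (X w)).
Proof. exact: (measurableT_comp (measurable_finite_young HPhi)). Qed.

Lemma le_integral_finite_young X Y : measurable_fun [set: Omega] X ->
  measurable_fun [set: Omega] Y -> (forall w, `|X w| <= `|Y w|) ->
  (\int[P]_w Phi (X w) <= \int[P]_w Phi (Y w))%E.
Proof.
move=> mX mY XY; apply: ge0_le_integral => //.
- exact: measurable_finite_young_comp.
- exact: measurable_finite_young_comp.
- by move=> w _; exact: le_finite_young.
Qed.

Lemma orlicz_heart_dominated X Y : measurable_fun [set: Omega] X ->
  (forall w, `|X w| <= `|Y w|) -> heart Y -> heart X.
Proof.
move=> mX XY [mY hY]; split=> // l l0; apply: le_lt_trans (hY l l0).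
apply: (@le_integral_finite_young (fun w => l * X w) (fun w => l * Y w)).
- by apply: measurable_funM => //; exact: measurable_cst.
- by apply: measurable_funM => //; exact: measurable_cst.
- by move=> w; rewrite !normrM ler_wpM2l.
Qed.

Lemma orlicz_heart_cst (c : R) : heart (cst c).
Proof.
split=> [|l l0]; first exact: measurable_cst.
rewrite (_ : (fun w => _) = cst (Phi (l * c)%R))//.
rewrite integral_cst// [X in (_ * X)%E](_ : _ = 1%E) ?mule1; last first.
  exact: probability_setT.
exact: finite_young_lty HPhi _.
Qed.

Lemma orlicz_heart_bounded X (C : R) : measurable_fun [set: Omega] X ->
  (forall w, `|X w| <= C) -> heart X.
Proof.
move=> mX XC; apply: (orlicz_heart_dominated mX _ (orlicz_heart_cst C)) => w.
by rewrite (le_trans (XC w))// ler_norm.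
Qed.

Lemma integral_finite_young_convex (t : R) X Y : 0 < t < 1 ->
  measurable_fun [set: Omega] X -> measurable_fun [set: Omega] Y ->
  (\int[P]_w Phi (t * X w + (1 - t) * Y w)%R <=
   t%:E * \int[P]_w Phi (X w) + (1 - t)%:E * \int[P]_w Phi (Y w))%E.
Proof.
apply: integral_convex => //; first exact: measurable_finite_young.
exact: finite_young_convex.
Qed.

Lemma orlicz_heart_subspace : linear_subspace heart.
Proof.
split.
- exact: orlicz_heart_cst.
- move=> X Y [mX hX] [mY hY]; split=> [|l l0]; first exact: measurable_funD.
  (* [l (X + Y)] is the midpoint of [2 l X] and [2 l Y]; membership in the heart covers the doubled
     scale. *)
  have l20 : 0 < 2 * l by rewrite mulr_gt0.
  have h2 : 0 < (2^-1 : R) < 1 by lra.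
  have ml Z : measurable_fun [set: Omega] Z ->
      measurable_fun [set: Omega] (fun w => 2 * l * Z w : R).
    by move=> mZ; apply: measurable_funM => //; exact: measurable_cst.
  have := integral_finite_young_convex h2 (ml _ mX) (ml _ mY).
  under eq_integral => w _.
    rewrite (_ : _ + _ = l * (X w + Y w)); last by field.
    over.
  move=> /le_lt_trans; apply.
  by rewrite lte_add_pinfty// lte_mul_pinfty ?lee_fin ?hX ?hY//; lra.
- move=> c X [mX hX]; split=> [|l l0].
    by apply: measurable_funM => //; exact: measurable_cst.
  have cl0 : 0 < l * (`|c| + 1) by rewrite mulr_gt0// ltr_pwDr.
  apply: le_lt_trans (hX _ cl0).
  apply: (@le_integral_finite_young (fun w => l * (c * X w))
                                    (fun w => l * (`|c| + 1) * X w)).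
  + apply: measurable_funM; first exact: measurable_cst.
    by apply: measurable_funM => //; exact: measurable_cst.
  + by apply: measurable_funM => //; exact: measurable_cst.
  + move=> w; rewrite mulrA !normrM ler_wpM2r// ler_wpM2l//.
    by rewrite (@ger0_norm _ (_ + 1)) ?addr_ge0// lerDl.
Qed.

Lemma luxemburg_norm_le X (l : R) : 0 < l ->
  (\int[P]_w Phi (X w / l)%R <= 1)%E -> (lux X <= l%:E)%E.
Proof. by move=> l0 Xl; apply: ereal_inf_lbound; exists l. Qed.

Lemma luxemburg_norm_lt X (l : R) : measurable_fun [set: Omega] X ->
  (lux X < l%:E)%E -> 0 < l /\ (\int[P]_w Phi (X w / l)%R <= 1)%E.
Proof.
move=> mX /ereal_inf_lt[_ [k [k0 Xk] <-]]; rewrite lte_fin => kl.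
have l0 := lt_trans k0 kl; split=> //; apply: le_trans Xk.
apply: (@le_integral_finite_young (fun w => X w / l) (fun w => X w / k)).
- by apply: measurable_funM => //; exact: measurable_cst.
- by apply: measurable_funM => //; exact: measurable_cst.
- move=> w; rewrite !normrM ler_wpM2l// !gtr0_norm ?invr_gt0//.
  by rewrite lef_pV2// ltW.
Qed.

Lemma luxemburg_norm_ge0 X : (0 <= lux X)%E.
Proof. by apply: le_ereal_inf_tmp => _ [l [l0 _] <-]; rewrite lee_fin ltW. Qed.

(** With [c] the modular plus 1, convexity gives [E[Phi(X / c)] <= E[Phi(X)] / c <= 1]. *)
Lemma luxemburg_norm_le_modular X : heart X ->
  (lux X <= \int[P]_w Phi (X w) + 1)%E.
Proof.
move=> [mX hX].
have := hX 1 ltr01; under eq_integral do rewrite mul1r.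
have I0 : (0 <= \int[P]_w Phi (X w))%E by exact: integral_ge0.
move=> Ioo; have Ifin : (\int[P]_w Phi (X w))%E \is a fin_num.
  by rewrite ge0_fin_numE.
pose c := fine (\int[P]_w Phi (X w))%E + 1.
have c1 : 1 <= c by rewrite lerDr fine_ge0.
have c0 : 0 < c by rewrite (lt_le_trans ltr01).
rewrite -(fineK Ifin) -EFinD -/c.
apply: luxemburg_norm_le => //.
apply: (@le_trans _ _ (\int[P]_w (c^-1%:E * Phi (X w))))%E.
  apply: ge0_le_integral => //.
  - apply: (@measurable_finite_young_comp (fun w => X w / c)).
    by apply: measurable_funM => //; exact: measurable_cst.
  - by apply: measurable_funeM; exact: measurable_finite_young_comp.
  - move=> w _; rewrite mulrC; apply: finite_young_scale.
    by rewrite invr_ge0 (ltW c0) invf_le1.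
rewrite ge0_integralZl//; last 2 first.
- exact: measurable_finite_young_comp.
- by rewrite lee_fin invr_ge0 ltW.
by rewrite -(fineK Ifin) -EFinM lee_fin ler_pdivrMl// mulr1 lerDl.
Qed.

Lemma luxemburg_norm_fin_num X : heart X -> lux X \is a fin_num.
Proof.
move=> hX; rewrite ge0_fin_numE ?luxemburg_norm_ge0//.
apply: le_lt_trans (luxemburg_norm_le_modular hX) _.
rewrite lte_add_pinfty ?ltry//.
by have := hX.2 1 ltr01; under eq_integral do rewrite mul1r.
Qed.

(** A seminorm on functions, since null variables are not identified; sublinearity is all that
    Hahn-Banach asks for. *)
Definition heart_norm X : R := fine (lux X).

Lemma heart_normK X : heart X -> lux X = (heart_norm X)%:E.
Proof. by move=> hX; rewrite /heart_norm fineK// luxemburg_norm_fin_num. Qed.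

Lemma heart_norm_ge0 X : 0 <= heart_norm X.
Proof. by rewrite fine_ge0// luxemburg_norm_ge0. Qed.

Lemma heart_norm_le X (l : R) : heart X -> 0 < l ->
  (\int[P]_w Phi (X w / l)%R <= 1)%E -> heart_norm X <= l.
Proof.
by move=> hX l0 Xl; rewrite -lee_fin -heart_normK// luxemburg_norm_le.
Qed.

Lemma heart_norm_lt X (l : R) : heart X -> heart_norm X < l ->
  0 < l /\ (\int[P]_w Phi (X w / l)%R <= 1)%E.
Proof.
move=> hX Xl; apply: luxemburg_norm_lt; first by case: hX.
by rewrite heart_normK// lte_fin.
Qed.

Lemma sublinear_heart_norm : sublinear_on heart heart_norm.
Proof.
have HS := orlicz_heart_subspace.
split=> [X Y hX hY|c X c0 hX].
  apply/ler_addgt0Pl => e e0.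
  have e2 (z : R) : z < z + e / 2 by rewrite ltrDl divr_gt0.
  have [a0 Ia] := heart_norm_lt hX (e2 (heart_norm X)).
  have [b0 Ib] := heart_norm_lt hY (e2 (heart_norm Y)).
  set a := _ + _ in a0 Ia; set b := _ + _ in b0 Ib.
  have -> : e + (heart_norm X + heart_norm Y) = a + b by rewrite /a /b; field.
  apply: heart_norm_le; [exact: (subspaceD HS)|exact: addr_gt0|].
  have ab0 : 0 < a + b by rewrite addr_gt0.
  (* [(X + Y) / (a + b)] is the convex combination of [X / a] and [Y / b] with these weights. *)
  have t01 : 0 < a / (a + b) < 1.
    by rewrite divr_gt0//= ltr_pdivrMr// mul1r ltrDl.
  have m (Z : Omega -> R) (l : R) : measurable_fun [set: Omega] Z ->
      measurable_fun [set: Omega] (fun w => Z w / l).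
    by move=> mZ; apply: measurable_funM => //; exact: measurable_cst.
  have := integral_finite_young_convex t01 (m _ a hX.1) (m _ b hY.1).
  under eq_integral => w _.
    rewrite (_ : _ + _ = (X w + Y w) / (a + b)); last first.
      by field; rewrite !gt_eqF.
    over.
  move=> /le_trans; apply.
  have -> : 1%E = ((a / (a + b))%:E * 1 + (1 - a / (a + b))%:E * 1)%E :> \bar R.
    by rewrite !mule1 -EFinD addrC subrK.
  have [t0 t1] : (0 <= (a / (a + b))%:E)%E /\ (0 <= (1 - a / (a + b))%:E)%E.
    by rewrite !lee_fin subr_ge0; case/andP: t01 => /ltW -> /ltW ->.
  exact: leeD (lee_wpmul2l t0 Ia) (lee_wpmul2l t1 Ib).
apply/ler_addgt0Pl => e e0.
have Xe : heart_norm X < e / c + heart_norm X by rewrite ltrDr divr_gt0.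
have [a0 Ia] := heart_norm_lt hX Xe.
have -> : e + c * heart_norm X = c * (e / c + heart_norm X).
  by field; rewrite gt_eqF.
apply: heart_norm_le; [exact: (subspaceZ HS)|exact: mulr_gt0|].
under eq_integral => w _.
  rewrite (_ : (c *: X) w / _ = X w / (e / c + heart_norm X)); last first.
    by rewrite /= /GRing.scale /= -mulf_div divff ?mul1r// gt_eqF.
  over.
by [].
Qed.

(** Order continuity of the norm: dominated convergence for [Phi (X n / c)], with majorant
    [Phi (Y / c)], integrable for every [c] because [Y] is in the heart. *)
Lemma heart_norm_dominated_cvg0 (X : nat -> Omega -> R^o) Y : heart Y ->
  (forall n, measurable_fun [set: Omega] (X n)) ->
  (forall n w, `|X n w| <= `|Y w|) -> (forall w, X ^~ w @ \oo --> (0 : R)) ->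
  forall c : R, 0 < c -> \forall n \near \oo, heart_norm (X n) <= c.
Proof.
move=> hY mX XY X0 c c0.
have hX n := orlicz_heart_dominated (mX n) (XY n) hY.
have mXc n : measurable_fun [set: Omega] (fun w => X n w / c).
  by apply: measurable_funM => //; exact: measurable_cst.
have mYc : measurable_fun [set: Omega] (fun w => Y w / c).
  by apply: measurable_funM; [exact: hY.1|exact: measurable_cst].
have cvgI : (\int[P]_w Phi (X n w / c)%R)%E @[n --> \oo] -->
            (\int[P]_w (cst 0 w))%E.
  apply: (@dominated_cvg _ _ _ P _ measurableT _ _ (fun w => Phi (Y w / c)%R)).
  - by move=> n; exact: (@measurable_finite_young_comp (fun w => X n w / c)).
  - move=> w _.
    have Phi1 : (fine (Phi 1))%:E = Phi 1 by rewrite fineK ?finite_young_fin_num.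
    have cvgb : (`|X n w / c| * fine (Phi 1))%:E @[n --> \oo] --> 0%E.
      apply: cvg_EFin; first by near=> n.
      rewrite /comp/= -[X in _ --> X](mul0r (fine (Phi 1))).
      apply: cvgM; last exact: cvg_cst.
      rewrite -(normr0 R); apply: cvg_norm; rewrite -(mul0r c^-1).
      by apply: cvgM; [exact: X0|exact: cvg_cst].
    apply: (squeeze_cvge _ (cvg_cst _) cvgb).
    (* Once [|X n w| < c], convexity gives [Phi (X n w / c) <= |X n w / c| Phi 1], which replaces
       continuity of [Phi] at 0. *)
    have : \forall n \near \oo, `|X n w| < c.
      have := X0 w; move/cvgrPdist_lt => /(_ c c0).
      by apply: filterS => n; rewrite sub0r normrN.
    apply: filterS => n Xc; rewrite Phi_ge0/= EFinM Phi1.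
    rewrite -(finite_young_norm (X n w / c)) -[X in Phi X]mulr1.
    apply: finite_young_scale.
    by rewrite normr_ge0/= normrM normfV (gtr0_norm c0) ler_pdivrMr// mul1r ltW.
  - by move=> w _; exact: finite_young_fin_num.
  - apply/integrableP; split.
      exact: (@measurable_finite_young_comp (fun w => Y w / c)).
    under eq_integral do rewrite gee0_abs//.
    have c'0 : 0 < c^-1 by rewrite invr_gt0.
    by have := hY.2 _ c'0; under eq_integral do rewrite mulrC.
  - move=> n w _; rewrite gee0_abs//; apply: le_finite_young.
    by rewrite !normrM ler_wpM2r.
move: cvgI; rewrite integral0 => /fine_cvgP[Ifin /cvgrPdist_lt/(_ _ ltr01)].
apply: filterS2 Ifin => n Ifin; rewrite /= sub0r normrN => I1.
apply: heart_norm_le => //; rewrite -(fineK Ifin) lee_fin ltW//.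
exact: le_lt_trans (ler_norm _) I1.
Unshelve. all: by end_near. Qed.

End OrliczHeart.

(** * Integral representation of bounded linear functionals on the heart *)

Section HeartDual.
Import HBNNSimple.
Context {d : measure_display} {Omega : measurableType d} {R : realType}.
Variables (P : probability Omega R) (Phi : R -> \bar R).
Hypothesis HPhi : finite_young Phi.

Local Notation heart := (orlicz_heart P Phi : set (Omega -> R^o)).

Variables (l : (Omega -> R^o) -> R) (K : R).
Hypotheses (l_linear : linear_on heart l) (K0 : 0 <= K).
Hypothesis l_le : forall X, heart X -> l X <= K * heart_norm P Phi X.

Let HS := orlicz_heart_subspace P HPhi.

Lemma heart_dual0 : l 0 = 0.
Proof.
rewrite -[X in l X](scale0r (0 : Omega -> R^o)) l_linear.2 ?mul0r//.
exact: subspace0 HS.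
Qed.

Lemma heart_dualN X : heart X -> l (- X) = - l X.
Proof. by move=> hX; rewrite -scaleN1r l_linear.2// mulN1r. Qed.

Lemma heart_dual_dominated_cvg0 (X : nat -> Omega -> R^o) Y : heart Y ->
  (forall n, measurable_fun [set: Omega] (X n)) ->
  (forall n w, `|X n w| <= `|Y w|) -> (forall w, X ^~ w @ \oo --> (0 : R)) ->
  l (X n) @[n --> \oo] --> (0 : R).
Proof.
move=> hY mX XY X0; apply/cvgrPdist_le => e e0.
(* [K] may be 0, hence the division by [K + 1]. *)
have K1 : 0 < K + 1 by rewrite ltr_pwDr.
have c0 : 0 < e / (K + 1) by rewrite divr_gt0.
have hX n := orlicz_heart_dominated HPhi (mX n) (XY n) hY.
have := heart_norm_dominated_cvg0 HPhi hY mX XY X0 c0.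
have mNX n : measurable_fun [set: Omega] (- X n).
  exact: measurableT_comp (mX n).
have NXY n w : `|(- X n) w| <= `|Y w| by rewrite normrN XY.
have NX0 w : (fun n => (- X n) w) @ \oo --> (0 : R).
  by rewrite -oppr0; apply: cvgN; exact: X0.
have := heart_norm_dominated_cvg0 HPhi hY mNX NXY NX0 c0.
have Ke x : x <= e / (K + 1) -> K * x <= e.
  move=> /(ler_wpM2l K0)/le_trans; apply.
  by rewrite mulrCA; apply: ler_piMr; rewrite ?(ltW e0)// ler_pdivrMr// mul1r lerDl.
apply: filterS2 => n /Ke N1 /Ke N2; rewrite sub0r normrN ler_norml.
rewrite (le_trans (l_le (hX n)) N2) andbT lerNl -heart_dualN//.
by rewrite (le_trans (l_le (subspaceN HS (hX n))) N1).
Qed.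

Lemma orlicz_heart_indic A : measurable A -> heart \1_A.
Proof.
move=> mA; apply: (@orlicz_heart_bounded _ _ _ _ _ HPhi _ 1).
  exact: measurable_indic.
by move=> w; rewrite indicE; case: (_ \in _); rewrite ?normr1 ?normr0.
Qed.

Lemma heart_dual_indicU A B : measurable A -> measurable B ->
  A `&` B = set0 -> l \1_(A `|` B) = l \1_A + l \1_B.
Proof.
move=> mA mB AB0; rewrite -l_linear.1; [|exact: orlicz_heart_indic..].
congr l; apply/funext => w; rewrite /= /GRing.add /= !indicE in_setU.
have : w \notin A `&` B by rewrite AB0 in_set0.
rewrite in_setI; case: (w \in A); case: (w \in B) => //= _.
- by rewrite addr0.
- by rewrite add0r.
- by rewrite addr0.
Qed.

Definition dual_charge (A : set Omega) : \bar R := (l \1_A)%:E.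

Let dual_charge0 : dual_charge set0 = 0%E.
Proof.
by rewrite /dual_charge indic0 (_ : cst 0 = 0)// heart_dual0.
Qed.

Let dual_charge_fin_num A : measurable A -> dual_charge A \is a fin_num.
Proof. by []. Qed.

(** The remainders [C n] of the union decrease to the empty set; their indicators are dominated by
    1, so order continuity sends [l] of them to 0. *)
Let dual_charge_sigma_additive : semi_sigma_additive dual_charge.
Proof.
move=> F mF tF mUF.
pose B n := \big[setU/set0]_(i < n) F i.
have mB n : measurable (B n) by exact: bigsetU_measurable.
have BE n : (\sum_(0 <= i < n) dual_charge (F i))%E = (l \1_(B n))%:E.
  elim: n => [|n ih]; first by rewrite big_nil /B big_ord0 -dual_charge0.
  rewrite big_nat_recr//= ih /dual_charge -EFinD /B big_ord_recr/=.
  rewrite heart_dual_indicU//; first exact: mB.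
  apply: (@trivIset_bigsetUI _ predT) => //.
  by rewrite /predT /= trueE.
under eq_fun do rewrite BE.
suff cvB : l \1_(B n) @[n --> \oo] --> l \1_(\bigcup_n F n).
  by apply: cvg_EFin => //; near=> n.
pose C n := \bigcup_n F n `\` B n.
have mC n : measurable (C n) by exact: measurableD.
have BC n : l \1_(B n) = l \1_(\bigcup_n F n) - l \1_(C n).
  rewrite -[X in _ = l \1_X - _](@setDUK _ (B n)); last first.
    by rewrite /B -bigcup_mkord; apply: bigcup_sub => i _; exact: bigcup_sup.
  rewrite heart_dual_indicU; [by rewrite addrK|exact: mB|exact: mC|].
  by rewrite setDE setICA setICr setI0.
suff cvC : l \1_(C n) @[n --> \oo] --> (0 : R).
  have -> : (fun n => l \1_(B n)) =
      cst (l \1_(\bigcup_n F n)) - (fun n => l \1_(C n)).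
    by apply/funext => n; exact: BC.
  by rewrite -[X in _ --> X]subr0; apply: cvgB => //; exact: cvg_cst.
apply: (heart_dual_dominated_cvg0 (orlicz_heart_cst P HPhi 1)).
- by move=> n; exact: measurable_indic.
- move=> n w; rewrite indicE normr1.
  by case: (_ \in _); rewrite ?normr1 ?normr0.
- move=> w; apply: cvg_near_cst.
  have [[k _ Fkw]|nF] := pselect ((\bigcup_n F n) w).
    exists k.+1 => // n /= kn; rewrite indicE memNset// => -[_]; apply.
    by rewrite /B -bigcup_mkord; exists k.
  by near=> n; rewrite indicE memNset// => -[].
Unshelve. all: by end_near. Qed.

HB.instance Definition _ := isCharge.Build _ _ _ dual_charge
  dual_charge0 dual_charge_fin_num dual_charge_sigma_additive.

(** The indicator of a null set has norm 0, since [Phi (1_A / e)] vanishes almost everywhere for all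
    [e > 0]; the bound on [l] is applied to it and to its negative. *)
Lemma dual_charge_dominates : dual_charge `<< P.
Proof.
apply/null_content_dominatesP => A mA PA0; congr EFin.
have hA := orlicz_heart_indic mA; have hNA := subspaceN HS hA.
have N0 (X : Omega -> R^o) : heart X -> (forall w, ~ A w -> X w = 0) ->
    heart_norm P Phi X <= 0.
  move=> hX XA; apply/ler_addgt0Pl => e e0; rewrite addr0.
  apply: heart_norm_le => //.
  rewrite (ae_eq_integral (cst 0%E))//.
  + by rewrite integral0.
  + apply: (measurable_finite_young_comp HPhi (X := fun w => X w / e)).
    by apply: measurable_funM; [exact: hX.1|exact: measurable_cst].
  + exists A; split=> // w /= /not_implyP[_ XnA]; apply: contrapT => nA.
    by apply: XnA; rewrite XA// mul0r (finite_young0 HPhi).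
apply/eqP; rewrite eq_le; apply/andP; split.
  apply: le_trans (l_le hA) _; rewrite mulr_ge0_le0// N0// => w Aw.
  by rewrite indicE memNset.
rewrite -oppr_le0 -heart_dualN//; apply: le_trans (l_le hNA) _.
rewrite mulr_ge0_le0// N0// => w Aw.
by rewrite /GRing.opp /= indicE memNset// oppr0.
Qed.

Definition dual_density : Omega -> R :=
  fun w => fine (Radon_Nikodym dual_charge P w).

Local Notation X := dual_density.

Lemma dual_density_integrable : P.-integrable [set: Omega] (EFin \o X).
Proof.
apply: eq_integrable (Radon_Nikodym_integrable dual_charge_dominates) => //.
move=> w _; rewrite /= fineK//.
exact: Radon_Nikodym_fin_num dual_charge_dominates.
Qed.

Lemma measurable_dual_density : measurable_fun [set: Omega] X.
Proof.
by apply/measurable_EFinP; exact: measurable_int dual_density_integrable.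
Qed.

Lemma dual_density_indic A : measurable A ->
  (\int[P]_w (X w * \1_A w)%:E = (l \1_A)%:E)%E.
Proof.
move=> mA; rewrite -[RHS]/(dual_charge A).
rewrite (Radon_Nikodym_integral dual_charge_dominates mA) [RHS]integral_mkcond.
apply: eq_integral => w _; rewrite patchE indicE EFinM fineK; last first.
  exact: Radon_Nikodym_fin_num dual_charge_dominates.
by case: ifPn; rewrite ?mule1 ?mule0.
Qed.

Lemma dual_density_simple (c : nat -> R) (A : nat -> set Omega) n :
  (forall i, measurable (A i)) ->
  let W w := \sum_(i < n) c i * \1_(A i) w in
  [/\ heart W, P.-integrable [set: Omega] (fun w => (X w * W w)%:E) &
      (\int[P]_w (X w * W w)%:E = (l W)%:E)%E].
Proof.
move=> mA; elim: n => [|n [hW iW IW]] W.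
  have W0 : W = 0 :> (Omega -> R^o) by apply/funext => w; rewrite /W big_ord0.
  have XW0 : (fun w => (X w * W w)%:E) = cst 0%E.
    by apply/funext => w; rewrite W0 mulr0.
  split; first by rewrite W0; exact: subspace0 HS.
    by rewrite XW0; exact: integrable0.
  rewrite XW0 integral0 W0; congr EFin.
  by rewrite heart_dual0.
set W' := (fun w => _) in hW iW IW.
have iA : P.-integrable [set: Omega] (fun w => (X w * \1_(A n) w)%:E).
  apply: le_integrable dual_density_integrable => //.
    apply/measurable_EFinP; apply: measurable_funM => //.
    exact: measurable_dual_density.
  move=> w _; rewrite lee_fin normrM indicE.
  by case: (_ \in _); rewrite ?normr1 ?mulr1// normr0 mulr0.
have hA := orlicz_heart_indic (mA n).
have WE : W = W' + c n *: (\1_(A n) : Omega -> R^o).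
  by apply/funext => w; rewrite /W big_ord_recr.
have XWE : (fun w => (X w * W w)%:E) =
    (fun w => (X w * W' w)%:E) \+ (fun w => (c n)%:E * (X w * \1_(A n) w)%:E)%E.
  apply/funext => w; rewrite WE /= -EFinM -EFinD mulrCA -mulrDr.
  by [].
split.
- by rewrite WE; apply: (subspaceD HS) => //; exact: (subspaceZ HS).
- by rewrite XWE; apply: integrableD => //; exact: integrableZl.
- rewrite XWE integralD//; last exact: integrableZl.
  rewrite IW integralZl// dual_density_indic// WE l_linear.1//.
    by rewrite l_linear.2.
  exact: (subspaceZ HS).
Qed.

(** Simple functions increase to [W]. The integrals converge by dominated convergence, with majorant
    [|X W|], and the values of [l] by order continuity. *)
Lemma dual_density_ge0 W : heart W -> (forall w, 0 <= W w) ->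
  P.-integrable [set: Omega] (fun w => (X w * W w)%:E) ->
  (\int[P]_w (X w * W w)%:E = (l W)%:E)%E.
Proof.
move=> hW W0 iW; have mW := hW.1.
have mEW : measurable_fun [set: Omega] (EFin \o W) by exact/measurable_EFinP.
pose g := nnsfun_approx measurableT mEW.
pose s n : Omega -> R := g n.
have s_rep n : [/\ heart (s n),
    P.-integrable [set: Omega] (fun w => (X w * s n w)%:E) &
    (\int[P]_w (X w * s n w)%:E = (l (s n))%:E)%E].
  pose e := finmap.enum_fset (fset_set (range (g n))).
  have := @dual_density_simple (fun i => nth 0 e i)
    (fun i => g n @^-1` [set nth 0 e i]) (size e).
  have -> : (fun w => \sum_(i < size e) nth 0 e i *
      \1_(g n @^-1` [set nth 0 e i]) w) = s n.
    by apply/funext => w; rewrite /s fimfunEord.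
  by apply=> i; exact: measurable_sfunP.
have sW n w : 0 <= s n w <= W w.
  rewrite /s fun_ge0/= -lee_fin /g nnsfun_approxE.
  by apply: (@le_approx _ _ _ setT (EFin \o W)) => // x _; exact: W0.
have s_cvg w : s ^~ w @ \oo --> W w.
  have := @cvg_nnsfun_approx _ _ _ _ measurableT _ mEW (fun w _ => W0 w) w Logic.I.
  by move=> /fine_cvg.
have cvgl : l (s n) @[n --> \oo] --> l W.
  pose D n : Omega -> R^o := fun w => W w - s n w.
  have lD n : l (s n) = l W - l (D n).
    have [hs _ _] := s_rep n.
    have -> : D n = W - s n by [].
    rewrite (l_linear.1 _ _ hW (subspaceN HS hs)) heart_dualN//; lra.
  suff cvD : l (D n) @[n --> \oo] --> (0 : R).
    have -> : (fun n => l (s n)) = cst (l W) - (fun n => l (D n)).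
      by apply/funext => n; exact: lD.
    by rewrite -[X in _ --> X]subr0; apply: cvgB => //; exact: cvg_cst.
  apply: (heart_dual_dominated_cvg0 hW).
  - by move=> n; exact: measurable_funB.
  - move=> n w; have /andP[s0 sw] := sW n w.
    by rewrite /D !ger0_norm ?subr_ge0// gerBl.
  - by move=> w; rewrite -(subrr (W w)); apply: cvgB => //; exact: cvg_cst.
have cvgI : (\int[P]_w (X w * s n w)%:E)%E @[n --> \oo] -->
            (\int[P]_w (X w * W w)%:E)%E.
  apply: (@dominated_cvg _ _ _ P _ measurableT _ _ (fun w => `|(X w * W w)%:E|%E)).
  - by move=> n; have [_ i _] := s_rep n; exact: measurable_int i.
  - move=> w _; apply: cvg_EFin; first by near=> n.
    by apply: cvgM => //; exact: cvg_cst.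
  - by [].
  - exact: integrable_abse.
  - move=> n w _; have /andP[s0 sw] := sW n w.
    by rewrite lee_fin !normrM ler_wpM2l// !ger0_norm.
rewrite -(cvg_lim _ cvgI)//; apply/cvg_lim => //.
have -> : (fun n => \int[P]_w (X w * s n w)%:E)%E = (fun n => (l (s n))%:E).
  by apply/funext => n; have [_ _ ->] := s_rep n.
by apply: cvg_EFin => //; near=> n.
Unshelve. all: by end_near. Qed.

(** Integrability of [X W] is a premise because the lemma must first be applied to bounded [W], in
    order to show that [X] lies in L^Uhat; only then does the premise hold on the whole heart. *)
Lemma dual_density_rep W : heart W ->
  P.-integrable [set: Omega] (fun w => (X w * W w)%:E) ->
  (\int[P]_w (X w * W w)%:E = (l W)%:E)%E.
Proof.
move=> hW iW; have mW := hW.1.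
pose p (Z : Omega -> R^o) : Omega -> R^o := fun w => Num.max (Z w : R) (0 : R).
have mp (Z : Omega -> R^o) : measurable_fun [set: Omega] Z ->
    measurable_fun [set: Omega] (p Z : Omega -> R).
  by move=> mZ; apply: measurable_maxr => //; exact: measurable_cst.
have pZ (Z : Omega -> R^o) w : `|p Z w| <= `|Z w|.
  by rewrite /p; have [_|_] := leP (Z w : R) (0 : R); rewrite ?normr0.
have hp (Z : Omega -> R^o) : heart Z -> heart (p Z).
  by move=> hZ; exact: (orlicz_heart_dominated HPhi (mp _ hZ.1) (pZ Z) hZ).
have p0 (Z : Omega -> R^o) w : 0 <= p Z w by rewrite /p le_max lexx orbT.
have ip (Z : Omega -> R^o) : heart Z -> (forall w, `|Z w| <= `|W w|) ->
    P.-integrable [set: Omega] (fun w => (X w * p Z w)%:E).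
  move=> hZ ZW; apply: le_integrable iW => //.
    apply/measurable_EFinP; apply: measurable_funM; last exact: mp hZ.1.
    exact: measurable_dual_density.
  by move=> w _; rewrite lee_fin !normrM ler_wpM2l// (le_trans (pZ Z w)).
have hN := subspaceN HS hW.
have WE : W = p W - p (- W).
  apply/funext => w; rewrite /p /GRing.add /GRing.opp /=.
  by case: (leP (W w) 0); case: (leP (- W w) 0); lra.
have ipW := ip _ hW (fun w => lexx _).
have ipN : P.-integrable [set: Omega] (fun w => (X w * p (- W) w)%:E).
  by apply: ip => // w; rewrite normrN.
transitivity (\int[P]_w ((X w * p W w)%:E - (X w * p (- W) w)%:E))%E.
  by apply: eq_integral => w _; rewrite {1}WE -EFinB -mulrBr.
rewrite integralB_EFin// !dual_density_ge0//; [|exact: hp..].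
rewrite -EFinB; congr EFin.
by rewrite {3}WE l_linear.1 ?heart_dualN//;
  [exact: hp|exact: hp|exact/(subspaceN HS)/hp].
Qed.

End HeartDual.

(** * Duality *)

(** Positive and negative parts are compared separately, which covers integrands of either sign with
    infinite integral, such as [U (xi w)] in weak duality. *)
Lemma le_integral_measurable {d : measure_display} {Omega : measurableType d}
    {R : realType} (P : probability Omega R) (f g : Omega -> \bar R) :
  measurable_fun [set: Omega] f -> measurable_fun [set: Omega] g ->
  (forall w, (f w <= g w)%E) -> (\int[P]_w f w <= \int[P]_w g w)%E.
Proof.
move=> mf mg fg'.
have fg : {in [set: Omega], forall w, (f w <= g w)%E} by move=> w _.
rewrite integralE [leRHS]integralE leeB//.
- apply: ge0_le_integral => //.
  + exact: measurable_funepos.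
  + exact: measurable_funepos.
  + by move=> w /mem_set; exact: funepos_le.
- apply: ge0_le_integral => //.
  + exact: measurable_funeneg.
  + exact: measurable_funeneg.
  + by move=> w /mem_set; exact: funeneg_le.
Qed.

Section Duality.
Context {d : measure_display} {Omega : measurableType d} {R : realType}.
Variables (P : probability Omega R) (U : R -> \bar R).
Hypotheses (HU : utility U) (Uinf : superlinear_at_ninfty U).

Local Notation V := (conjugate_utility U).
Local Notation Uhat := (young_utility U).
Local Notation Vhat := (conjugate_young_utility U).
Local Notation heart := (orlicz_heart P Vhat : set (Omega -> R^o)).
Local Notation N := (heart_norm P Vhat).

Lemma finite_young_conjugate : finite_young Vhat.
Proof.
split.
- exact: conjugate_young_utility_ge0.
- exact: conjugate_young_utility0.
- exact: conjugate_young_utility_lty.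
- exact: conjugate_young_utilityN.
- move=> t x y t01; rewrite conjugate_young_utilityE.
  apply: conjugate_utility_convex_ereal => // z.
  by rewrite -conjugate_young_utilityE; exact: conjugate_young_utility_ge0.
- rewrite conjugate_young_utilityE; exact: measurable_conjugate_utility.
Qed.

Let HV := finite_young_conjugate.
Let HS := orlicz_heart_subspace P HV.

Lemma measurable_young_utility : measurable_fun [set: R] Uhat.
Proof.
apply: measurableT_comp => //.
apply: (measurableT_comp (measurable_utility HU)).
apply: measurableT_comp => //.
Qed.

(** Hölder's inequality, from Young's inequality for [l |X|] and [|Y| / k] with [k] just above the
    norm of [Y]: [E|X Y| <= (k / l) (A + 1)]. *)
Lemma orlicz_pairing (X : Omega -> R) : orlicz_space P Uhat X ->
  exists2 c : R, 0 <= c & forall Y, heart Y ->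
    P.-integrable [set: Omega] (fun w => (X w * Y w)%:E) /\
    (\int[P]_w `|(X w * Y w)%:E| <= (c * N Y)%:E)%E.
Proof.
move=> [mX [l l0 IX]].
have mlX : measurable_fun [set: Omega] (fun w => l * X w).
  by apply: measurable_funM => //; exact: measurable_cst.
have mUX : measurable_fun [set: Omega] (fun w => Uhat (l * X w)).
  exact: (measurableT_comp measurable_young_utility mlX).
have I0 : (0 <= \int[P]_w Uhat (l * X w)%R)%E.
  by apply: integral_ge0 => w _; exact: young_utility_ge0.
have Ifin : (\int[P]_w Uhat (l * X w)%R)%E \is a fin_num.
  by rewrite ge0_fin_numE.
pose A := fine (\int[P]_w Uhat (l * X w)%R)%E.
have A0 : 0 <= A by rewrite fine_ge0.
exists ((A + 1) / l) => [|Y hY]; first by rewrite divr_ge0 ?addr_ge0// ltW.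
have mXY : measurable_fun [set: Omega] (fun w => (X w * Y w)%:E).
  by apply/measurable_EFinP; apply: measurable_funM => //; exact: hY.1.
have le_pairing : (\int[P]_w `|(X w * Y w)%:E| <= ((A + 1) / l * N Y)%:E)%E.
  apply/lee_addgt0Pr => e e0; rewrite -EFinD.
  (* The excess over the norm is tuned so that [k / l * (A + 1)] is the claimed bound plus [e]. *)
  pose k := N Y + e * l / (A + 1).
  have Nk : N Y < k by rewrite ltrDl divr_gt0 ?mulr_gt0// ltr_pwDr.
  have [k0 Ik] := heart_norm_lt HV hY Nk.
  have mYk : measurable_fun [set: Omega] (fun w => Y w / k).
    by apply: measurable_funM; [exact: hY.1|exact: measurable_cst].
  have mVY : measurable_fun [set: Omega] (fun w => Vhat (Y w / k)).
    exact: (measurableT_comp (measurable_finite_young HV) mYk).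
  have kl0 : 0 < k / l by rewrite divr_gt0.
  have -> : (A + 1) / l * N Y + e = k / l * (A + 1).
    by rewrite /k; field; rewrite !gt_eqF// ltr_pwDr.
  apply: (@le_trans _ _
      (\int[P]_w ((k / l)%:E * (Uhat (l * X w)%R + Vhat (Y w / k)%R)))%E).
    apply: ge0_le_integral => //.
    - exact: measurableT_comp.
    - by apply: measurable_funeM; exact: emeasurable_funD.
    - move=> w _; have := young_fenchel HU `|l * X w| `|Y w / k|.
      rewrite (finite_young_norm HV) /young_utility normr_id.
      move=> h; have kl0' : (0 <= (k / l)%:E)%E by rewrite lee_fin ltW.
      apply: le_trans (lee_wpmul2l kl0' h).
      rewrite -EFinM lee_fin !normrM normfV (gtr0_norm l0) (gtr0_norm k0).
      rewrite le_eqVlt; apply/orP; left; apply/eqP; field.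
      by rewrite !gt_eqF.
  rewrite ge0_integralZl//; last 3 first.
  - exact: emeasurable_funD.
  - move=> w _; apply: adde_ge0; first exact: young_utility_ge0.
    exact: conjugate_young_utility_ge0.
  - by rewrite lee_fin ltW.
  rewrite ge0_integralD//; last 2 first.
  - by move=> w _; exact: young_utility_ge0.
  - by move=> w _; exact: conjugate_young_utility_ge0.
  have kl0' : (0 <= (k / l)%:E)%E by rewrite lee_fin ltW.
  rewrite (EFinM (k / l)); apply: (lee_wpmul2l kl0').
  by rewrite EFinD /A fineK//; exact: leeD2l.
split=> //; apply/integrableP; split=> //.
by apply: le_lt_trans le_pairing _; rewrite ltry.
Qed.

Lemma orlicz_integrable (X : Omega -> R) : orlicz_space P Uhat X ->
  P.-integrable [set: Omega] (EFin \o X).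
Proof.
move=> /orlicz_pairing[c _ /(_ _ (orlicz_heart_cst P HV 1))[h _]].
by apply: eq_integrable h => // w _; rewrite /= mulr1.
Qed.

Lemma expectation_mulE (X Y : Omega -> R) :
  ('E_P[X \* Y] = \int[P]_w (X w * Y w)%:E)%E.
Proof. by rewrite unlock. Qed.

Lemma weak_duality (xi W : Omega -> R) :
  measurable_fun [set: Omega] xi -> measurable_fun [set: Omega] W ->
  P.-integrable [set: Omega] (fun w => (xi w * W w)%:E) ->
  (integral_functional P U xi <=
   integral_functional P V W + \int[P]_w (xi w * W w)%:E)%E.
Proof.
move=> mxi mW ixiW.
have mVW : measurable_fun [set: Omega] (fun w => V (W w)).
  exact: (measurableT_comp (@measurable_conjugate_utility _ U) mW).
have V0 w : (0 <= V (W w))%E by exact: conjugate_utility_ge0.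
have mUxi : measurable_fun [set: Omega] (fun w => U (xi w)).
  exact: (measurableT_comp (measurable_utility HU) mxi).
have [Voo|] := boolP (integral_functional P V W < +oo)%E; last first.
  rewrite -leNgt leye_eq => /eqP ->.
  have /fineK <- := integrable_fin_num measurableT ixiW.
  by rewrite addye// leey.
have iV : P.-integrable [set: Omega] (fun w => V (W w)).
  by apply/integrableP; split=> //; under eq_integral do rewrite gee0_abs//.
rewrite /integral_functional -integralD//.
apply: le_integral_measurable => //.
  apply: emeasurable_funD => //; exact: measurable_int ixiW.
by move=> w; rewrite -leeBlDr//; exact: conjugate_utility_ge.
Qed.

Variable B : Omega -> R.
Hypothesis HB : orlicz_space P Uhat B.

Definition dual_objective (W : Omega -> R) : \bar R :=
  (integral_functional P V W + 'E_P[W \* B])%E.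

Local Notation J := dual_objective.

(** The variables at which J is real: on the heart [E[W B]] is always finite, so only I_V can be
    infinite. *)
Definition dual_domain (W : Omega -> R^o) : Prop :=
  heart W /\ (integral_functional P V W < +oo)%E.

Lemma pairing_fin_num (X : Omega -> R) Y : orlicz_space P Uhat X -> heart Y ->
  (\int[P]_w (X w * Y w)%:E)%E \is a fin_num.
Proof.
move=> /orlicz_pairing[c _ h] /h[iXY _].
exact: (integrable_fin_num measurableT iXY).
Qed.

Lemma expectation_mulC (X Y : Omega -> R) :
  ('E_P[X \* Y] = \int[P]_w (Y w * X w)%:E)%E.
Proof. by rewrite expectation_mulE; under eq_integral do rewrite mulrC. Qed.

Lemma integral_conjugate_ge0 W : (0 <= integral_functional P V W)%E.
Proof. by apply: integral_ge0 => w _; exact: conjugate_utility_ge0. Qed.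

Lemma dual_objective_fin_num W : dual_domain W -> J W \is a fin_num.
Proof.
move=> [hW VW]; rewrite /J expectation_mulC fin_numD pairing_fin_num// andbT.
by rewrite ge0_fin_numE// integral_conjugate_ge0.
Qed.

Lemma dual_objective_fine W : dual_domain W ->
  fine (J W) = fine (integral_functional P V W) +
               fine (\int[P]_w (B w * W w)%:E)%E.
Proof.
move=> [hW VW]; rewrite /J expectation_mulC fineD ?pairing_fin_num//.
by rewrite ge0_fin_numE// integral_conjugate_ge0.
Qed.

Lemma dual_objective_lty W : heart W -> (J W < +oo)%E -> dual_domain W.
Proof.
move=> hW JW; split=> //; rewrite ltey; apply: contraTneq JW => VW.
rewrite /J VW expectation_mulC -(fineK (pairing_fin_num HB hW)).
by rewrite addye// ltxx.
Qed.

(** Places the test variables of [conjugate_interchange] in the domain of J. *)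
Lemma dual_domain_bounded (W : Omega -> R) (C : R) :
  measurable_fun [set: Omega] W ->
  (forall w, `|W w| <= C /\ (V (W w) <= C%:E)%E) -> dual_domain W.
Proof.
move=> mW WC; split.
  by apply: (@orlicz_heart_bounded _ _ _ P _ HV W C mW) => w; exact: (WC w).1.
apply: (@le_lt_trans _ _ (\int[P]_w (cst C%:E w))%E).
  apply: ge0_le_integral => //.
  - by move=> w _; exact: conjugate_utility_ge0.
  - exact: (measurableT_comp (@measurable_conjugate_utility _ U) mW).
  - by move=> w _; exact: (WC w).2.
rewrite integral_cst// [X in (_ * X)%E](_ : _ = 1%E) ?mule1 ?ltry//.
exact: probability_setT.
Qed.

Lemma dual_domain_nonempty : exists W, dual_domain W.
Proof.
have [b hb] := conjugate_utility_finite_ray HU Uinf.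
have Fb : V b \is a fin_num by rewrite ge0_fin_numE ?hb ?conjugate_utility_ge0.
exists (cst b).
apply: (@dual_domain_bounded (cst b) (Num.max `|b| (fine (V b)))).
  exact: measurable_cst.
move=> w /=; rewrite le_max lexx; split=> //.
by rewrite -(fineK Fb) lee_fin le_max lexx orbT.
Qed.

Lemma dual_objective_convex (t : R) W1 W2 : 0 < t < 1 ->
  dual_domain W1 -> dual_domain W2 ->
  dual_domain (t *: W1 + (1 - t) *: W2) /\
  fine (J (t *: W1 + (1 - t) *: W2)) <= t * fine (J W1) + (1 - t) * fine (J W2).
Proof.
move=> t01 D1 D2; have [[h1 V1] [h2 V2]] := (D1, D2).
have /andP[t0 t1] := t01.
set W := _ + _.
have hW : heart W by apply: (subspaceD HS); exact: (subspaceZ HS).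
have IW : (integral_functional P V W <= t%:E * integral_functional P V W1 +
    (1 - t)%:E * integral_functional P V W2)%E.
  apply: integral_convex => //; [|exact: measurable_conjugate_utility| | |].
  - exact: conjugate_utility_ge0.
  - move=> s x y s01; apply: conjugate_utility_convex_ereal => // z.
    exact: conjugate_utility_ge0.
  - exact: h1.1.
  - exact: h2.1.
have F1 : integral_functional P V W1 \is a fin_num.
  by rewrite ge0_fin_numE ?integral_conjugate_ge0.
have F2 : integral_functional P V W2 \is a fin_num.
  by rewrite ge0_fin_numE ?integral_conjugate_ge0.
have DW : dual_domain W.
  split=> //; apply: le_lt_trans IW _.
  by rewrite -(fineK F1) -(fineK F2) -!EFinM -EFinD ltry.
split=> //.
have [c _ pair] := orlicz_pairing HB.
have [i1 _] := pair _ h1; have [i2 _] := pair _ h2.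
have EW : (\int[P]_w (B w * W w)%:E = t%:E * \int[P]_w (B w * W1 w)%:E +
    (1 - t)%:E * \int[P]_w (B w * W2 w)%:E)%E.
  rewrite -!integralZl// -integralD//; [|exact: integrableZl..].
  apply: eq_integral => w _; rewrite -!EFinM -EFinD; congr EFin.
  by rewrite (_ : W w = t * W1 w + (1 - t) * W2 w)//; ring.
rewrite !dual_objective_fine// EW.
have FW : integral_functional P V W \is a fin_num.
  by rewrite ge0_fin_numE ?integral_conjugate_ge0//; exact: DW.2.
move: IW; rewrite -(fineK F1) -(fineK F2) -(fineK FW) -!EFinM -EFinD lee_fin.
rewrite -(fineK (pairing_fin_num HB h1)) -(fineK (pairing_fin_num HB h2)).
by rewrite -!EFinM -EFinD /=; lra.
Qed.

End Duality.

(** * Separation and the primal candidate *)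

Section Separation.
Context {d : measure_display} {Omega : measurableType d} {R : realType}.
Variables (P : probability Omega R) (U : R -> \bar R) (B : Omega -> R).
Hypotheses (HU : utility U) (Uinf : superlinear_at_ninfty U).
Hypothesis HB : orlicz_space P (young_utility U) B.

Local Notation V := (conjugate_utility U).
Local Notation Uhat := (young_utility U).
Local Notation Vhat := (conjugate_young_utility U).
Local Notation heart := (orlicz_heart P Vhat : set (Omega -> R^o)).
Local Notation N := (heart_norm P Vhat).
Local Notation J := (dual_objective P U B).
Local Notation dom := (@dual_domain _ _ _ P U).

Let HV := finite_young_conjugate HU Uinf.
Let HS := orlicz_heart_subspace P HV.

Lemma integrable_mul_bounded (X W : Omega -> R) (C : R) :
  P.-integrable [set: Omega] (EFin \o X) -> measurable_fun [set: Omega] W ->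
  (forall w, `|W w| <= C) ->
  P.-integrable [set: Omega] (fun w => (X w * W w)%:E).
Proof.
move=> iX mW WC.
apply: (le_integrable measurableT _ _ (integrableZl measurableT C iX)).
  apply/measurable_EFinP; apply: measurable_funM => //.
  by apply/measurable_EFinP; exact: measurable_int iX.
move=> w _; rewrite -EFinM lee_fin !normrM mulrC ler_wpM2r//.
by rewrite (le_trans (WC w))// ler_norm.
Qed.

(* Testing the functional against sign(X) W, with W a bounded minimizer of
   V(W) - |X| W / K, the interchange formula yields E[Uhat(X / K)] <= 1. *)
Lemma dual_density_orlicz (l : (Omega -> R^o) -> R) (K : R) : 0 < K ->
  forall (l_lin : linear_on heart l)
    (l_le : forall X, heart X -> l X <= K * N X) (K0 : 0 <= K),
  orlicz_space P Uhat (dual_density HV l_lin K0 l_le).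
Proof.
move=> Kgt0 l_lin l_le K0; set X := dual_density _ _ _ _.
have iX := dual_density_integrable HV l_lin K0 l_le; rewrite -/X in iX.
have mX := measurable_dual_density HV l_lin K0 l_le; rewrite -/X in mX.
have Ki0 : 0 < K^-1 by rewrite invr_gt0.
split=> //; exists K^-1 => //.
pose xi : Omega -> R := fun w => - `|K^-1 * X w|.
have mxi : measurable_fun [set: Omega] xi.
  apply: measurableT_comp => //; apply: measurableT_comp => //.
  by apply: measurable_funM => //; exact: measurable_cst.
have ixi : P.-integrable [set: Omega] (EFin \o xi).
  apply: (le_integrable measurableT _ _ (integrableZl measurableT K^-1 iX)).
    exact/measurable_EFinP.
  by move=> w _; rewrite -EFinM lee_fin /xi normrN normr_id.
have I_ge : ((- 1)%:E <= integral_functional P U xi)%E.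
  apply: (@conjugate_interchange _ _ _ P U HU Uinf xi (- 1) ixi) => W C mW WC.
  have [hW VW] := dual_domain_bounded P HU Uinf mW WC.
  pose h : Omega -> R^o := fun w => if 0 <= X w then W w else - W w.
  have mh : measurable_fun [set: Omega] h.
    apply: measurable_fun_ifT => //.
      by apply: measurable_fun_ler => //; exact: measurable_cst.
    exact: measurableT_comp.
  have hE w : `|h w| = `|W w| by rewrite /h; case: ifP; rewrite ?normrN.
  have hh : heart h.
    by apply: (@orlicz_heart_bounded _ _ _ P _ HV h C mh) => w; rewrite hE (WC w).1.
  have Xh w : X w * h w = `|X w| * W w.
    by rewrite /h; case: ger0P => // _; rewrite mulrN mulNr.
  have iXh : P.-integrable [set: Omega] (fun w => (X w * h w)%:E).
    by apply: (@integrable_mul_bounded X h C) => // w; rewrite hE (WC w).1.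
  have iV : P.-integrable [set: Omega] (fun w => V (W w)).
    apply/integrableP; split.
      exact: (measurableT_comp (@measurable_conjugate_utility _ U) mW).
    by under eq_integral do rewrite gee0_abs ?conjugate_utility_ge0//.
  have FV : integral_functional P V W \is a fin_num.
    by rewrite /integral_functional; apply: integrable_fin_num.
  (* The norm exceeds the modular by at most 1, and [Vhat <= V]. This 1 is the origin of the lower
     bound [- 1] for E[U(xi)]. *)
  have Nh : N h <= fine (integral_functional P V W) + 1.
    rewrite -lee_fin -heart_normK// EFinD fineK//.
    apply: le_trans (luxemburg_norm_le_modular HV hh) _; apply: leeD2r.
    apply: ge0_le_integral => //.
    - by move=> w _; exact: conjugate_young_utility_ge0.
    - exact: (measurable_finite_young_comp HV).
    - exact: measurable_int iV.
    - move=> w _; rewrite -(finite_young_norm HV) hE (finite_young_norm HV).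
      exact: conjugate_young_utility_le.
  have lh := dual_density_rep hh iXh; rewrite -/X in lh.
  have xiE w : (xi w * W w)%:E = ((- K^-1)%:E * (X w * h w)%:E)%E.
    by rewrite -EFinM Xh /xi normrM (gtr0_norm Ki0) !mulNr mulrA.
  have ixiW : P.-integrable [set: Omega] (fun w => (xi w * W w)%:E).
    by apply: (@integrable_mul_bounded xi W C) => // w; exact: (WC w).1.
  rewrite integralD// -/(integral_functional P V W).
  under [X in (_ <= _ + X)%E]eq_integral do rewrite xiE.
  rewrite integralZl// lh -(fineK FV) -EFinM -EFinD lee_fin.
  have : K^-1 * l h <= K^-1 * (K * (fine (integral_functional P V W) + 1)).
    by rewrite ler_pM2l// (le_trans (l_le _ hh))// ler_pM2l.
  by rewrite mulKf ?gt_eqF//; lra.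
apply: (@le_lt_trans _ _ 1%E); last by rewrite ltry.
have := I_ge; rewrite /integral_functional.
have -> : (fun w => U (xi w)) = (fun w => - Uhat (K^-1 * X w)%R)%E.
  by apply/funext => w; rewrite /young_utility oppeK.
rewrite integral_ge0N; last by move=> w _; exact: young_utility_ge0.
by rewrite EFinN leeN2.
Qed.

Variable C : set (Omega -> R).
Hypothesis HC : C `<=` orlicz_space P Uhat.

Local Notation C' := (polar P U C).

Lemma polar0 : C' 0.
Proof.
split=> [|X CX]; first exact: subspace0 HS.
by rewrite expectation_mulE integral0_eq// => w _; rewrite mulr0.
Qed.

Lemma polarD Y1 Y2 : C' Y1 -> C' Y2 -> C' (Y1 + Y2).
Proof.
move=> [h1 p1] [h2 p2]; split=> [|X CX]; first exact: (subspaceD HS).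
have [c _ pair] := orlicz_pairing HU Uinf (HC CX).
have [i1 _] := pair _ h1; have [i2 _] := pair _ h2.
rewrite expectation_mulE.
under eq_integral do rewrite mulrDr EFinD.
rewrite integralD// -!expectation_mulE; exact: adde_le0 (p1 _ CX) (p2 _ CX).
Qed.

Lemma polarZ (c : R) (Y : Omega -> R^o) : 0 <= c -> C' Y -> C' (c *: Y).
Proof.
move=> c0 [hY pY]; split=> [|X CX]; first exact: (subspaceZ HS).
have [k _ pair] := orlicz_pairing HU Uinf (HC CX).
have [iY _] := pair _ hY; rewrite expectation_mulE.
have -> : (fun w => (X w * (c *: Y) w)%:E) =
    (fun w => c%:E * (X w * Y w)%:E)%E.
  by apply/funext => w; rewrite -EFinM mulrCA.
by rewrite integralZl// -expectation_mulE mule_ge0_le0// pY.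
Qed.

Lemma separation (K s : R) : 0 < K ->
  (forall W Y, dom W -> C' Y -> s - fine (J W) <= K * N (W - Y)) ->
  exists2 X, bipolar P U C X & (s%:E <= integral_functional P U (B \+ X)%R)%E.
Proof.
move=> Kgt0 sK; have K0 := ltW Kgt0.
have NS := sublinear_heart_norm P HV.
pose p (X : Omega -> R^o) := K * N X.
have pS : sublinear_on heart p.
  split=> [X Y hX hY|c X c0 hX].
    by rewrite /p -mulrDr ler_wpM2l// NS.1.
  by rewrite /p mulrCA ler_wpM2l// NS.2.
have [W0 dW0] := dual_domain_nonempty P HU Uinf.
(* The constraints of this cone say at once that [l >= s - J] on the domain of J ([t = 1], [Y = 0])
   and [l <= 0] on the polar ([t = 0]). Convexity of J makes the cone stable under sums. *)
pose A := [set a : (Omega -> R^o) * R | exists t W Y,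
  [/\ 0 <= t, dom W, C' Y, a.1 = t *: W - Y & a.2 <= t * (s - fine (J W))]].
have Ap : cone_below heart p A.
  split.
  - exists 0, W0, 0; split=> //=; first exact: polar0.
      by rewrite scale0r subr0.
    by rewrite mul0r.
  - move=> a b [t1 [W1 [Y1 [t10 d1 c1 a1 a2]]]] [t2 [W2 [Y2 [t20 d2 c2 b1 b2]]]].
    have c12 := polarD c1 c2.
    move: t10; rewrite le_eqVlt => /predU1P[t1E|t10].
      exists t2, W2, (Y1 + Y2); split=> //=.
        by rewrite a1 b1 -t1E scale0r sub0r opprD addrCA.
      by move: a2; rewrite -t1E mul0r => a2; lra.
    move: t20; rewrite le_eqVlt => /predU1P[t2E|t20].
      exists t1, W1, (Y1 + Y2); split=> //=; first exact: ltW.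
        by rewrite a1 b1 -t2E scale0r sub0r opprD addrA.
      by move: b2; rewrite -t2E mul0r => b2; lra.
    have t12 : 0 < t1 + t2 by rewrite addr_gt0.
    pose t := t1 / (t1 + t2).
    have t01 : 0 < t < 1 by rewrite divr_gt0//= ltr_pdivrMr// mul1r ltrDl.
    have [dW JW] := dual_objective_convex HU Uinf HB t01 d1 d2.
    exists (t1 + t2), (t *: W1 + (1 - t) *: W2), (Y1 + Y2); split=> //=.
    + exact: ltW.
    + rewrite scalerDr !scalerA a1 b1 opprD addrACA; congr (_ *: _ + _ *: _ + _).
        by rewrite /t mulrC divfK// gt_eqF.
      by rewrite /t; field; rewrite gt_eqF.
    + have : (t1 + t2) * fine (J (t *: W1 + (1 - t) *: W2)) <=
          t1 * fine (J W1) + t2 * fine (J W2).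
        apply: le_trans (ler_wpM2l (ltW t12) JW) _.
        by rewrite le_eqVlt; apply/orP; left; apply/eqP; rewrite /t; field;
          rewrite gt_eqF.
      lra.
  - move=> c a c0 [t [W [Y [t0 dW cY a1 a2]]]].
    exists (c * t), W, (c *: Y); split=> //=.
    + by rewrite mulr_ge0// ltW.
    + by apply: polarZ => //; exact: ltW.
    + by rewrite a1 scalerBr scalerA.
    + by rewrite -mulrA ler_pM2l.
  - move=> a [t [W [Y [t0 dW cY a1 a2]]]].
    have hY : heart Y by case: cY.
    have ha : heart a.1.
      rewrite a1; apply: (subspaceD HS); first exact: (subspaceZ HS) dW.1.
      exact: (subspaceN HS hY).
    split=> //; move: t0; rewrite le_eqVlt => /predU1P[t0|t0].
      apply: le_trans a2 _; rewrite -t0 mul0r /p mulr_ge0//.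
      exact: heart_norm_ge0.
    (* The polar is a cone and [t W - Y = t (W - Y / t)], so the assumed bound at [W] and [Y / t]
       scales by [t]. *)
    have tiY : C' (t^-1 *: Y) by apply: polarZ => //; rewrite invr_ge0 ltW.
    apply: (le_trans a2); apply: le_trans (ler_wpM2l (ltW t0) (sK _ _ dW tiY)) _.
    have hWY : heart (W - t^-1 *: Y).
      by apply: (subspaceD HS); [exact: dW.1|exact: (subspaceN HS tiY.1)].
    rewrite /p mulrCA -(sublinearZ HS NS (ltW t0) hWY) scalerBr scalerA.
    by rewrite divff ?gt_eqF// scale1r a1.
have [l [l_lin lp lA]] := mazur_orlicz HS pS Ap.
pose X := dual_density HV l_lin K0 lp.
have oX : orlicz_space P Uhat X by exact: dual_density_orlicz.
have [c _ pairX] := orlicz_pairing HU Uinf oX.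
have rep W : heart W -> (\int[P]_w (X w * W w)%:E = (l W)%:E)%E.
  by move=> hW; apply: dual_density_rep => //; have [] := pairX _ hW.
have lY Y : C' Y -> l Y <= 0.
  move=> cY; have AY : A (- Y, 0).
    by exists 0, W0, Y; split=> //=; rewrite ?scale0r ?sub0r// mul0r.
  have /= := lA _ AY; rewrite (heart_dualN l_lin) ?oppr_ge0//.
  by case: cY.
have lW W : dom W -> s - fine (J W) <= l W.
  move=> dW; have AW : A (W, s - fine (J W)).
    exists 1, W, 0; split=> //=; first exact: polar0.
      by rewrite scale1r subr0.
    by rewrite mul1r.
  exact: lA AW.
exists X.
  split=> // Y cY; rewrite expectation_mulE rep; last by case: cY.
  by rewrite lee_fin lY.
have [cB _ pairB] := orlicz_pairing HU Uinf HB.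
apply: (@conjugate_interchange _ _ _ P U HU Uinf (B \+ X) s).
  exact: integrableD (orlicz_integrable HU Uinf HB) (orlicz_integrable HU Uinf oX).
move=> W M mW WM.
have dW := dual_domain_bounded P HU Uinf mW WM; have [hW VW] := dW.
have [iB _] := pairB _ hW; have [iXW _] := pairX _ hW.
have mBX : measurable_fun [set: Omega] (B \+ X).
  by apply: measurable_funD; [exact: HB.1|exact: oX.1].
have FV : integral_functional P V W \is a fin_num.
  by rewrite ge0_fin_numE// integral_conjugate_ge0.
have iV : P.-integrable [set: Omega] (fun w => V (W w)).
  apply/integrableP; split.
    exact: (measurableT_comp (@measurable_conjugate_utility _ U) mW).
  by under eq_integral do rewrite gee0_abs ?conjugate_utility_ge0//.
have -> : (fun w => V (W w) + ((B \+ X) w * W w)%:E)%E =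
    (fun w => V (W w) + ((B w * W w)%:E + (X w * W w)%:E))%E.
  by apply/funext => w; rewrite -EFinD -mulrDl.
rewrite integralD//; last exact: integrableD.
rewrite integralD// rep// -/(integral_functional P V W).
have FB := integrable_fin_num measurableT iB.
have := lW _ dW; rewrite dual_objective_fine//.
by rewrite -{2}(fineK FV) -{2}(fineK FB) -!EFinD lee_fin; lra.
Qed.

End Separation.

(** * Asymptotic weak duality and the approximating sequences *)

Section DualApproximation.
Context {d : measure_display} {Omega : measurableType d} {R : realType}.
Variables (P : probability Omega R) (U : R -> \bar R) (B : Omega -> R).
Hypotheses (HU : utility U) (Uinf : superlinear_at_ninfty U).
Hypothesis HB : orlicz_space P (young_utility U) B.

Local Notation V := (conjugate_utility U).
Local Notation Uhat := (young_utility U).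
Local Notation Vhat := (conjugate_young_utility U).
Local Notation heart := (orlicz_heart P Vhat : set (Omega -> R^o)).
Local Notation N := (heart_norm P Vhat).
Local Notation J := (dual_objective P U B).

Let HV := finite_young_conjugate HU Uinf.
Let HS := orlicz_heart_subspace P HV.

Variable C : set (Omega -> R).
Hypothesis HC : C `<=` orlicz_space P Uhat.

Local Notation C' := (polar P U C).

(** The constant depends on [X] alone, so the error vanishes as the norm of [Z] tends to 0, whatever
    the elements [Y] of the polar; [E[X Y] <= 0] is dropped. *)
Lemma dual_objective_ge X : C X -> exists2 c : R, 0 <= c &
  forall Y Z : Omega -> R^o, C' Y -> heart Z ->
  (integral_functional P U (B \+ X)%R <= J (Y + Z)%R + (c * N Z)%:E)%E.
Proof.
move=> CX; have oX := HC CX.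
have [c c0 pairX] := orlicz_pairing HU Uinf oX; exists c => // Y Z cY hZ.
have hY : heart Y by case: cY.
have hW : heart (Y + Z) by exact: (subspaceD HS).
have [cB _ /(_ _ hW)[iB _]] := orlicz_pairing HU Uinf HB.
have [iXY _] := pairX _ hY; have [iXZ XZ] := pairX _ hZ.
have iXW : P.-integrable [set: Omega] (fun w => (X w * (Y + Z) w)%:E).
  have -> : (fun w => (X w * (Y + Z) w)%:E) =
      (fun w => (X w * Y w)%:E) \+ (fun w => (X w * Z w)%:E).
    by apply/funext => w; rewrite /= -EFinD -mulrDr.
  exact: integrableD.
have XWE : (\int[P]_w (X w * (Y + Z) w)%:E =
    \int[P]_w (X w * Y w)%:E + \int[P]_w (X w * Z w)%:E)%E.
  rewrite -integralD//; apply: eq_integral => w _.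
  by rewrite -EFinD -mulrDr.
have BXWE : (fun w => ((B \+ X) w * (Y + Z) w)%:E) =
    (fun w => (B w * (Y + Z) w)%:E) \+ (fun w => (X w * (Y + Z) w)%:E).
  by apply/funext => w; rewrite /= -EFinD -mulrDl.
have := @weak_duality _ _ _ P U HU (B \+ X) (Y + Z).
rewrite BXWE integralD// => h.
apply: le_trans (h _ _ _) _.
- by apply: measurable_funD; [exact: HB.1|exact: oX.1].
- exact: hW.1.
- exact: integrableD.
rewrite /dual_objective expectation_mulC addeA; apply: leeD2l.
rewrite XWE -[leRHS]add0e; apply: leeD.
  by rewrite -expectation_mulE; case: cY => _; apply.
apply: le_trans XZ; apply: le_trans (lee_abs _) _.
by apply: le_abse_integral => //; exact: measurable_int iXZ.
Qed.

Lemma sub_bipolar : C `<=` bipolar P U C.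
Proof. by move=> X CX; split=> [|Y [_]]; [exact: HC|exact]. Qed.

Lemma dual_approximation (u e : R) : 0 < e ->
  (exists2 X, C X & (-oo < integral_functional P U (B \+ X)%R)%E) ->
  (optimal_utility P U B (bipolar P U C) <= u%:E)%E ->
  exists Z Y : Omega -> R^o,
    [/\ heart Z, N Z <= e, C' Y & (J (Y + Z)%R <= (u + e)%:E)%E].
Proof.
move=> e0 [X0 CX0 UX0] optu; apply: contrapT => noZY.
have IU X : bipolar P U C X -> (integral_functional P U (B \+ X)%R <= u%:E)%E.
  by move=> cX; apply: le_trans optu; apply: ereal_sup_ubound; exists X.
have IX0 := IU _ (sub_bipolar CX0).
pose a := fine (integral_functional P U (B \+ X0)%R).
have aE : integral_functional P U (B \+ X0)%R = a%:E.
  by rewrite /a fineK// fin_numElt UX0 (le_lt_trans IX0)// ltry.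
have au : a <= u by rewrite -lee_fin -aE.
have [c c0 Jge] := dual_objective_ge CX0.
(* This [K] gives u + e - J(W) <= K N(W - Y): the left-hand side is negative
   if N(W - Y) <= e, and weak duality with [X0] applies otherwise. *)
pose K := c + (u + e - a) / e.
have K0 : 0 < K by rewrite ltr_wpDl// divr_gt0//; lra.
have [|X cX] := @separation _ _ _ P U B HU Uinf HB C HC K (u + e) K0.
  move=> W Y dW cY.
  have hZ : heart (W - Y).
    by apply: (subspaceD HS); [exact: dW.1|exact: (subspaceN HS cY.1)].
  have WE : Y + (W - Y) = W by rewrite addrC subrK.
  have JW : (fine (J W))%:E = J W by rewrite fineK// dual_objective_fin_num.
  have [Ne|eN] := leP (N (W - Y)) e.
    have : u + e < fine (J W).
      rewrite ltNge; apply/negP => Jue; apply: noZY; exists (W - Y), Y.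
      by split=> //; rewrite WE -JW lee_fin.
    have : 0 <= K * N (W - Y) by rewrite mulr_ge0 ?heart_norm_ge0// ltW.
    lra.
  have := Jge _ _ cY hZ; rewrite WE aE -JW -EFinD lee_fin.
  have : (u + e - a) / e * e <= (u + e - a) / e * N (W - Y).
    by apply: ler_wpM2l; [rewrite divr_ge0//; lra|exact: ltW].
  by rewrite divfK ?gt_eqF// /K mulrDl; lra.
(* [X] is known to lie only in the bipolar, hence the bound [u] on the supremum over the bipolar. *)
by move=> /le_trans/(_ (IU _ cX)); rewrite lee_fin; lra.
Qed.

Lemma dual_sequence :
  (exists2 X, C X & (-oo < integral_functional P U (B \+ X)%R)%E) ->
  optimal_utility P U B C = optimal_utility P U B (bipolar P U C) ->
  exists Z Y : nat -> Omega -> R,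
    [/\ forall n, heart (Z n),
        luxemburg_norm P Vhat (Z n) @[n --> \oo] --> 0%E,
        forall n, C' (Y n) &
        J (Y n \+ Z n)%R @[n --> \oo] --> optimal_utility P U B C].
Proof.
move=> feas opt.
have optN : (-oo < optimal_utility P U B C)%E.
  have [X CX UX] := feas; apply: lt_le_trans UX _.
  by apply: ereal_sup_ubound; exists X.
case optE : (optimal_utility P U B C) optN => [u| |] // _.
- have He n : 0 < harmonic n :> R by rewrite invr_gt0.
  have optu : (optimal_utility P U B (bipolar P U C) <= u%:E)%E.
    by rewrite -opt optE.
  have [ZY ZYP] := choice (fun n => dual_approximation (He n) feas optu).
  have [Y YP] := choice ZYP.
  exists ZY, Y; split.
  + by move=> n; case: (YP n).
  + have -> : (fun n => luxemburg_norm P Vhat (ZY n)) = EFin \o (fun n => N (ZY n)).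
      by apply/funext => n; apply: heart_normK => //; case: (YP n).
    apply: cvg_EFin; first by near=> n.
    apply: (squeeze_cvgr _ (cvg_cst 0) cvg_harmonic).
    by near=> n; rewrite heart_norm_ge0; case: (YP n).
  + by move=> n; case: (YP n).
  + have dYZ n : dual_domain P U (Y n + ZY n).
      have [hZ _ cY JYZ] := YP n.
      apply: (dual_objective_lty HU Uinf HB).
        by apply: (subspaceD HS) => //; case: cY.
      by apply: le_lt_trans JYZ _; rewrite ltry.
    have FJ n : J (Y n + ZY n) \is a fin_num by exact: dual_objective_fin_num.
    apply/fine_cvgP; split; first by near=> n; exact: FJ.
    apply/cvgrPdist_le => e e0.
    have : ((u - e / 2)%:E < optimal_utility P U B C)%E.
      by rewrite optE lte_fin; lra.
    move=> /ereal_sup_gt[_ [X CX <-] UX].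
    have [c c0 Jge] := dual_objective_ge CX.
    (* Below this threshold both [harmonic n] and [c * harmonic n] are at most [e / 2]: the first
       bounds J from above, the second bounds the loss in weak duality with [X]. *)
    have t0 : 0 < e / 2 / (c + 1) by rewrite !divr_gt0// ltr_pwDr.
    have /cvgrPdist_lt/(_ _ t0) := @cvg_harmonic R.
    apply: filterS => n; rewrite sub0r normrN (gtr0_norm (He n)).
    have [hZ NZ cY JYZ] := YP n.
    rewrite ltr_pdivlMr ?ltr_pwDr// => hn.
    have cN : c * N (ZY n) <= c * harmonic n by rewrite ler_wpM2l.
    have ch : 0 <= c * harmonic n by rewrite mulr_ge0// ltW.
    have h0 := He n.
    have := le_trans (ltW UX) (Jge _ _ cY hZ).
    move: JYZ; rewrite -(fineK (FJ n)) -EFinD !lee_fin => J1 J2.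
    rewrite ler_norml /comp -[fine (J (Y n \+ ZY n))]/(fine (J (Y n + ZY n))).
    by lra.
(* If the optimal utility is infinite, weak duality at [Y = Z = 0] forces [J 0 = +oo], and the null
   sequences will do. *)
- have h0 : heart 0 := subspace0 HS.
  have c0 : C' 0 := polar0 P HU Uinf C.
  have J0 : J (0 + 0) = +oo%E.
    apply/eqP; rewrite -leye_eq -optE; apply: ge_ereal_sup => _ [X CX <-].
    have [c _ /(_ _ _ c0 h0)] := dual_objective_ge CX.
    by rewrite (sublinear0 HS (sublinear_heart_norm P HV)) mulr0 adde0.
  exists (fun=> 0), (fun=> 0); split=> //.
    rewrite heart_normK// (sublinear0 HS (sublinear_heart_norm P HV)).
    exact: cvg_cst.
  by rewrite -[J _]/(J (0 + 0)) J0; exact: cvg_cst.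
Unshelve. all: by end_near. Qed.

End DualApproximation.

Theorem proposition4p1 (d : measure_display) (Omega : measurableType d)
    (R : realType) (P : probability Omega R)
    (T : R) (F : R -> set (set Omega))
    (m : nat) (S : 'I_m -> R -> Omega -> R)
    (U : R -> \bar R) (B : Omega -> R)
    (T_ge0 : 0 <= T)
    (F_filtration : filtration T F)
    (S_semimartingale : forall i, semimartingale P T F (S i))
    (U_utility : utility U)
    (B_orlicz : orlicz_space P (young_utility U) B)
    (B_feasible : exists2 X, superreplicable P T F U S X &
                    utility_domain P U (B \+ X))
    (C_bipolar : optimal_utility P U B (superreplicable P T F U S) =
                 optimal_utility P U B
                   (bipolar P U (superreplicable P T F U S)))
    (U_superlinear : superlinear_at_ninfty U) :
  exists Z Y : nat -> Omega -> R,
    [/\ forall n, orlicz_heart P (conjugate_young_utility U) (Z n),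
        luxemburg_norm P (conjugate_young_utility U) (Z n)
          @[n --> \oo] --> 0%E,
        forall n, polar P U (superreplicable P T F U S) (Y n) &
        (integral_functional P (conjugate_utility U) (Y n \+ Z n)%R
           + 'E_P[((Y n \+ Z n) \* B)%R])%E
          @[n --> \oo] -->
        optimal_utility P U B (superreplicable P T F U S)].
Proof.
apply: dual_sequence => //; first by move=> X [].
by have [X CX [_ UX]] := B_feasible; exists X.
Qed.
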